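(* Suppose $T \subseteq \mathbb{R}^2$ is a lattice of area $1$ and let $Q$ be a bounded, Lebesgue measurable fundamental domain of $T$. Let also $G \subseteq T$ be a finite subset of lattice points and let the function $f:\mathbb{R}^2 \to \mathbb{C}$ (the coloring) be defined by $$ f(x) = \sum_{g \in G} z_g \chi_Q(x-g), $$ for some complex numbers $z_g$, $g \in G$. Then there is a straight line $S$ such that $f$ is measurable on $S$ and $$ \left|\int_S f\right| \ge C\, (\operatorname{diam} G)^{-1/2} \left(\sum_{g \in G} |z_g|^2\right)^{1/2}, $$ where $C$ is a positive constant that may depend on $T$ and $Q$ only.
   Context: A lattice $T \subseteq \mathbb{R}^2$ is a discrete additive subgroup of $\mathbb{R}^2$ whose linear span is $\mathbb{R}^2$; its area is its covolume, i.e. the area of a parallelogram spanned by a $\mathbb{Z}$-basis of $T$. A fundamental domain of $T$ is a set $Q \subseteq \mathbb{R}^2$ containing exactly one element from each coset of $T$ in $\mathbb{R}^2$; equivalently, $\mathbb{R}^2 = \bigcup_{t \in T}(t+Q)$ is a partition of $\mathbb{R}^2$. $\chi_Q$ denotes the indicator function of $Q$. $\operatorname{diam} G$ is the Euclidean diameter of $G$. Measurability of $f$ on a line $S$ and the integral $\int_S f$ are with respect to one-dimensional Lebesgue (arclength) measure on $S$. *)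

(* Defs.v *)
From HB Require Import structures.
From mathcomp Require Import all_boot all_order all_algebra.
From mathcomp Require Import finmap.
From mathcomp Require Import complex.
From mathcomp Require Import all_classical all_reals all_analysis.
From mathcomp Require Import measurable_realfun.

Set Implicit Arguments.
Unset Strict Implicit.
Unset Printing Implicit Defensive.

Import Order.TTheory GRing.Theory Num.Theory.
Import numFieldNormedType.Exports.
Import ComplexField.Normc.

Local Open Scope classical_set_scope.
Local Open Scope ring_scope.
Local Open Scope complex_scope.

(* The norm of the library on R * R is the sup norm, so the Euclidean one
   has to be defined. *)
Definition euclid {R : realType} (x : R * R) : R :=
  Num.sqrt (x.1 ^+ 2 + x.2 ^+ 2).

(* A finite set with at most one point has diameter 0 (sup set0 = 0), and
   0 `^ (- 2^-1) = 0: a lower bound proportional to diam A `^ (- 2^-1) has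
   content only when A has at least two points. *)
Definition diam {R : realType} (A : set (R * R)) : R :=
  sup [set euclid (x.1 - x.2) | x in A `*` A].

Definition is_lattice {R : realType} (T : set (R * R)) : Prop :=
  [/\ T 0,
      forall x y, T x -> T y -> T (x - y),
      T `<=` isolated T &
      forall x, exists (n : nat) (c : 'I_n -> R) (t : 'I_n -> R * R),
        (forall i, T (t i)) /\ x = \sum_(i < n) c i *: t i].

Definition is_Zbasis {R : realType} (T : set (R * R)) (u v : R * R) : Prop :=
  [/\ T u, T v &
      forall x, T x -> exists! m : int * int, x = u *~ m.1 + v *~ m.2].

Definition parallelogram_area {R : realType} (u v : R * R) : R :=
  `|u.1 * v.2 - u.2 * v.1|.

(* "T has covolume a"; the area does not depend on the choice of the basis. *)
Definition has_area {R : realType} (T : set (R * R)) (a : R) : Prop :=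
  exists u v, is_Zbasis T u v /\ parallelogram_area u v = a.

Definition is_fundamental_domain {R : realType} (T Q : set (R * R)) : Prop :=
  forall x, exists! q, Q q /\ T (q - x).

(* The measurable sets of the product are the Borel sets of the plane; the
   Lebesgue measurable ones are the unions of a Borel set and a null set. *)
Definition lebesgue_measurable2 {R : realType} (Q : set (R * R)) : Prop :=
  completed_algebra_gen
    (@lebesgue_measure R \x @lebesgue_measure R)%E Q.

Definition coloring {R : realType} (Q : set (R * R)) (G : {fset (R * R)})
    (z : R * R -> R[i]) (x : R * R) : R[i] :=
  \sum_(g <- G) z g * (\1_Q (x - g))%:C.

(* The straight line through p with direction u is given by
   t |-> p + t *: u; for a unit vector u this is an arclength
   parametrization. *)
Definition on_line {R : realType} (f : R * R -> R[i]) (p u : R * R) (t : R) :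
  R[i] := f (p + t *: u).

(* The domain carries the sigma-algebra of the completed measure, that is,
   Lebesgue (not only Borel) measurability is meant. *)
Definition measurable_on_line {R : realType} (f : R * R -> R[i])
    (p u : R * R) : Prop :=
  let X := caratheodory_type ((wlength (@idfun R))^*)%mu in
  measurable_fun [set: X] (fun t : X => complex.Re (on_line f p u t)) /\
  measurable_fun [set: X] (fun t : X => complex.Im (on_line f p u t)).

Definition line_integral {R : realType} (f : R * R -> R[i]) (p u : R * R) :
    R[i] :=
  (\int[@completed_lebesgue_measure R]_t complex.Re (on_line f p u t)) +i*
  (\int[@completed_lebesgue_measure R]_t complex.Im (on_line f p u t)).

(* Main.v *)
Require Import Defs.
From HB Require Import structures.
From mathcomp Require Import all_boot all_order all_algebra.
From mathcomp Require Import finmap.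
From mathcomp Require Import complex.
From mathcomp Require Import all_classical all_reals all_analysis.
From mathcomp Require Import measurable_realfun.
From mathcomp Require Import ring lra.

Set Implicit Arguments.
Unset Strict Implicit.
Unset Printing Implicit Defensive.

Import Order.TTheory GRing.Theory Num.Theory.
Import numFieldNormedType.Exports.
Import ComplexField.Normc.

Local Open Scope classical_set_scope.
Local Open Scope ring_scope.
Local Open Scope complex_scope.

(** Why the theorem is true.

    Taking real and imaginary parts reduces everything to a real colouring
    f p = \sum_(g <- G) x g * \1_Q (p - g).  Suppose that the integral of f
    over every line on which f is measurable is at most eps in absolute value.
    The energy of f at scale a is the integral over (p, q) of
    f p * f q / sqrt (a ^ 2 + |p - q| ^ 2), and it is compared with eps from
    above and with the weights x g from below.

    From above.  Let kappa a m s = a / (a ^ 2 * (1 + m ^ 2) + s ^ 2).  The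
    functions (x, y) |-> kappa a m (y - m * x) are constant on the lines of
    slope m, and their integral over all slopes m is pi / sqrt (a ^ 2 + x ^ 2 +
    y ^ 2) (integral_kappa_slope).  So the energy is an average over m of
    quadratic forms in the integrals of f over the lines of slope m
    (integral_shear).  These integrals are at most eps / sqrt (1 + m ^ 2) in
    the parameter x, they vanish outside an interval of length 2 * rho *
    sqrt (1 + m ^ 2) if f lives on a disc of radius rho, and kappa a m has
    integral pi / sqrt (1 + m ^ 2).  Hence every energy of f is at most
    2 * pi * rho * eps ^ 2, whatever a is (energy_bound).

    From below.  Subtract the energy at scale 2 * a from the energy at scale a.
    The new kernel riesz_gap a is nonnegative and integrable, and it is an
    approximate identity, up to normalization, as a tends to 0.  The difference
    of the energies is the integral of riesz_gap a v against the
    autocorrelation of f, the integral of f p * f (p + v) over p.  The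
    translates of Q by lattice points are disjoint, so the autocorrelation at v
    is at least \sum_g x g ^ 2 times the difference between the area of Q and
    twice the area of the part of Q that leaves Q when moved by v
    (autocorrelation_ge).  The latter tends to 0 with v (escape_cvg), so for a suitable a, which depends on Q
    only, the difference is at least a positive multiple of \sum_g x g ^ 2
    (exists_scale, tiles_energy).

    Together, \sum_g x g ^ 2 is at most a constant times rho * eps ^ 2.  One can
    take rho = diam G + O(1), which is O(diam G) because two distinct lattice
    points are never closer than some d > 0; this is the claim.

    Lebesgue measurability.  Q is a Borel set B up to a null set.  For each
    slope almost every line meets the translates of that null set in a null
    set (ae_null_section); on such a line the colouring is measurable and can
    be replaced by the one built from B (good_lines).  The energies only see
    almost every line of each slope, so these lines suffice. *)

(** * One-dimensional integrals *)

Section OneDim.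
Context {R : realType}.
Notation lam := (@lebesgue_measure R).

Lemma measurable_affine (c d : R) :
  measurable_fun [set: R] (fun x : R => c * x + d).
Proof. exact: measurable_funD. Qed.

Lemma lebesgue_measure_affine (c d : R) (A : set R) : 0 < c -> measurable A ->
  lam ((fun x : R => c * x + d) @^-1` A) = (c^-1%:E * lam A)%E.
Proof.
move=> c0 mA.
have c0' : 0 <= c by exact: ltW.
pose phi := (fun x : R => c * x + d) : R -> measurableTypeR R.
have mphi : measurable_fun [set: R] phi by exact: measurable_affine.
pose nu := mscale (NngNum c0') (pushforward lam phi).
have := @lebesgue_measure_unique R (nu mphi) _ A mA.
move=> ->.
  rewrite /nu /mscale/= /pushforward muleA -EFinM mulVf ?mul1e//.
  by rewrite gt_eqF.
move=> _ [[a b] _ <-].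
rewrite /nu /mscale/= /pushforward.
have E : phi @^-1` [set` `]a, b]] = [set` `](a - d) / c, (b - d) / c]].
  apply/seteqP; split => x /=; rewrite !in_itv/= /phi;
  by rewrite ltr_pdivrMr// ler_pdivlMr// ltrBlDr lerBrDr ![x * c]mulrC.
rewrite [X in _ = (_ * lam X)%E]E.
rewrite !lebesgue_measure_itv/= !lte_fin ltr_pM2r ?invr_gt0// ltrD2r.
case: ifPn => ab; last by rewrite mule0.
rewrite -!EFinB -EFinM; congr EFin.
by field; rewrite gt_eqF.
Qed.

Lemma ge0_integral_affine (c d : R) (f : R -> \bar R) : 0 < c ->
  measurable_fun [set: R] f -> (forall x, (0 <= f x)%E) ->
  (\int[lam]_x f (c * x + d)%R = c^-1%:E * \int[lam]_x f x)%E.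
Proof.
move=> c0 mf f0.
have ic0 : 0 <= c^-1 by rewrite invr_ge0 ltW.
pose phi := (fun x : R => c * x + d) : R -> measurableTypeR R.
have mphi : measurable_fun [set: R] phi by exact: measurable_affine.
have := @ge0_integral_pushforward _ _ (measurableTypeR R) (measurableTypeR R) R phi mphi lam
  setT f measurableT mf (fun x _ => f0 x).
rewrite preimage_setT => /esym; rewrite /comp/= => ->.
rewrite -(@ge0_integral_mscale _ _ R lam setT (measurableT) (NngNum ic0))//.
apply: eq_measure_integral => //= A mA _.
by rewrite /pushforward lebesgue_measure_affine.
Qed.

Lemma integral_affine (c d : R) (f : R -> \bar R) : 0 < c ->
  lam.-integrable setT f ->
  (\int[lam]_x f (c * x + d)%R = c^-1%:E * \int[lam]_x f x)%E.
Proof.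
move=> c0 jf; have mf := measurable_int _ jf.
rewrite [LHS]integralE [in RHS]integralE.
have := @ge0_integral_affine c d (f^\+)%E c0 (measurable_funepos mf) (funepos_ge0 f).
have := @ge0_integral_affine c d (f^\-)%E c0 (measurable_funeneg mf) (funeneg_ge0 f).
have fp := integrable_pos_fin_num measurableT jf.
have fc : (c^-1)%:E \is a fin_num by [].
rewrite (muleBr fc (fin_num_adde_defr _ fp)).
move=> <- <-; congr (_ - _)%E; apply: eq_integral => x _;
by rewrite ?funeposE ?funenegE.
Qed.

Lemma ge0_integral_shift (d : R) (f : R -> \bar R) :
  measurable_fun [set: R] f -> (forall x, (0 <= f x)%E) ->
  (\int[lam]_x f (x + d)%R = \int[lam]_x f x)%E.
Proof.
move=> mf f0; have := @ge0_integral_affine 1 d f ltr01 mf f0.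
by rewrite invr1 mul1e => <-; under [RHS]eq_integral do rewrite mul1r.
Qed.

Lemma integral_shift (d : R) (f : R -> \bar R) :
  measurable_fun [set: R] f ->
  (\int[lam]_x f (x + d)%R = \int[lam]_x f x)%E.
Proof.
move=> mf; rewrite [LHS]integralE [RHS]integralE.
have := @ge0_integral_shift d (f^\+)%E (measurable_funepos mf) (funepos_ge0 f).
have := @ge0_integral_shift d (f^\-)%E (measurable_funeneg mf) (funeneg_ge0 f).
move=> <- <-; congr (_ - _)%E; apply: eq_integral => x _;
by rewrite ?funeposE ?funenegE.
Qed.

(** The only integral that is evaluated in closed form; every kernel below is
    brought to this shape by completing a square. *)
Lemma integral_cauchy (al ga : R) : 0 < al -> 0 < ga ->
  (\int[lam]_s ((al * s ^+ 2 + ga)^-1)%:E = (pi / Num.sqrt (al * ga))%:E)%E.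
Proof.
move=> al0 ga0.
set r := Num.sqrt (al / ga).
have r0 : 0 < r by rewrite sqrtr_gt0 divr_gt0.
pose h := fun s : R => (ga^-1) / (1 + s ^+ 2).
have h0 s : 0 <= h s.
  by rewrite /h mulr_ge0 ?invr_ge0 ?(ltW ga0)// addr_ge0// sqr_ge0.
have den s : 1 + s ^+ 2 != 0 :> R by rewrite gt_eqF// ltr_pwDl// sqr_ge0.
have ch : continuous h.
  move=> s; apply: cvgM; first exact: cvg_cst.
  apply: cvgV => //.
  by apply: cvgD; [exact: cvg_cst|exact: exprn_continuous].
have mh : measurable_fun [set: R] (EFin \o h).
  by apply/measurable_EFinP; exact: continuous_measurable_fun.
transitivity (\int[lam]_s (EFin \o h) (r * s + 0)%R)%E.
  apply: eq_integral => s _ /=; rewrite /h addr0 exprMn /r sqr_sqrtr; last first.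
    by rewrite divr_ge0// ltW.
  congr EFin; rewrite -invfM; congr (_^-1).
  by field; rewrite gt_eqF.
rewrite (ge0_integral_affine _ r0 mh); last by move=> x; rewrite lee_fin.
rewrite ge0_symfun_integralT//; last first.
  by move=> s; rewrite /h/= sqrrN.
have -> : [set x : R | 0 <= x] = `[0, +oo[%classic.
  by apply/seteqP; split => x /=; rewrite in_itv/= andbT.
rewrite (@ge0_continuous_FTC2y R h (fun s => ga^-1 * atan s) 0 (ga^-1 * (pi / 2)))//; first last.
- by move=> s _; rewrite derive1E deriveZ//= derive_val.
- apply: cvg_at_right_filter.
  by apply: cvgM; [exact: cvg_cst|exact: continuous_atan].
- by apply: cvgM; [exact: cvg_cst|exact: cvgy_atan].
- exact: continuous_subspaceT.
rewrite atan0 mulr0 sube0 -!EFinM; congr EFin.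
have -> : Num.sqrt (al * ga) = r * ga.
  have -> : al * ga = (al / ga) * ga ^+ 2 by field; rewrite gt_eqF.
  by rewrite sqrtrM ?divr_ge0 ?ltW// sqrtr_sqr gtr0_norm.
by field; rewrite !gt_eqF.
Qed.

End OneDim.

(** * Ridge kernels and their average over all slopes *)

Section Kernels.
Context {R : realType}.
Notation lam := (@lebesgue_measure R).

(** For fixed m, a multiple of the Poisson kernel a / (a ^ 2 + t ^ 2) at the
    distance t = s / sqrt (1 + m ^ 2) between two lines of slope m whose
    intercepts differ by s.  The factor (1 + m ^ 2)^-1 is the density of the
    uniform measure on directions in terms of slopes. *)
Definition kappa (a m s : R) : R := a / (a ^+ 2 * (1 + m ^+ 2) + s ^+ 2).

Lemma kappa_den_gt0 (a m s : R) : 0 < a ->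
  0 < a ^+ 2 * (1 + m ^+ 2) + s ^+ 2.
Proof.
move=> a0; rewrite ltr_pwDl ?sqr_ge0// mulr_gt0 ?exprn_gt0//.
by rewrite ltr_pwDl// sqr_ge0.
Qed.

Lemma kappa_ge0 (a m s : R) : 0 < a -> 0 <= kappa a m s.
Proof. by move=> a0; rewrite divr_ge0 ?ltW ?kappa_den_gt0. Qed.

Lemma kappa_le (a m s : R) : 0 < a -> kappa a m s <= a^-1.
Proof.
move=> a0; rewrite /kappa ler_pdivrMr ?kappa_den_gt0// -ler_pdivrMl ?invr_gt0//.
rewrite invrK mulrDr mulr1 -expr2 -addrA lerDl addr_ge0// ?sqr_ge0//.
by rewrite mulr_ge0// sqr_ge0.
Qed.

Lemma one_plus_sqr_gt0 (m : R) : 0 < 1 + m ^+ 2.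
Proof. by rewrite ltr_pwDl// sqr_ge0. Qed.

Lemma integral_kappa (a m b : R) : 0 < a ->
  (\int[lam]_s (kappa a m (s - b))%:E =
   (pi / Num.sqrt (1 + m ^+ 2))%:E)%E.
Proof.
move=> a0.
have mk : measurable_fun [set: R] (fun s => (kappa a m s)%:E).
  apply/measurable_EFinP; apply: continuous_measurable_fun => s.
  apply: cvgM; first exact: cvg_cst.
  apply: cvgV; first by rewrite gt_eqF// kappa_den_gt0.
  by apply: cvgD; [exact: cvg_cst|exact: exprn_continuous].
rewrite (integral_shift (- b) mk).
have m0 := one_plus_sqr_gt0 m.
have am0 : 0 < a * (1 + m ^+ 2) by rewrite mulr_gt0.
have ai0 : 0 < a^-1 by rewrite invr_gt0.
transitivity (\int[lam]_s ((a^-1 * s ^+ 2 + a * (1 + m ^+ 2))^-1)%:E)%E.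
  apply: eq_integral => s _; congr EFin; rewrite /kappa.
  rewrite -[a in LHS]invrK -invfM invrK; congr (_^-1).
  by field; rewrite gt_eqF.
by rewrite integral_cauchy// mulrA mulVf ?mul1r// gt_eqF.
Qed.

(** The averaging formula: the ridge functions of all slopes add up to a radial
    kernel.  The denominator is a quadratic polynomial in m of discriminant
    -4 * a ^ 2 * (a ^ 2 + x ^ 2 + y ^ 2). *)
Lemma integral_kappa_slope (a x y : R) : 0 < a ->
  (\int[lam]_m (kappa a m (y - m * x))%:E =
   (pi / Num.sqrt (a ^+ 2 + x ^+ 2 + y ^+ 2))%:E)%E.
Proof.
move=> a0.
have ax0 : 0 < a ^+ 2 + x ^+ 2 by rewrite ltr_pwDl ?sqr_ge0// exprn_gt0.
have axy0 : 0 < a ^+ 2 + x ^+ 2 + y ^+ 2 by rewrite ltr_pwDl ?sqr_ge0.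
(* Completing the square in m around x * y / (a ^ 2 + x ^ 2). *)
set al := (a ^+ 2 + x ^+ 2) / a.
set ga := a * (a ^+ 2 + x ^+ 2 + y ^+ 2) / (a ^+ 2 + x ^+ 2).
have al0 : 0 < al by rewrite divr_gt0.
have ga0 : 0 < ga by rewrite divr_gt0// mulr_gt0.
pose h s : \bar R := ((al * s ^+ 2 + ga)^-1)%:E.
have mh : measurable_fun [set: R] h.
  apply/measurable_EFinP; apply: continuous_measurable_fun => s.
  apply: cvgV; first by rewrite gt_eqF// ltr_wpDl// mulr_ge0 ?sqr_ge0// ltW.
  apply: cvgD; last exact: cvg_cst.
  by apply: cvgM; [exact: cvg_cst|exact: exprn_continuous].
transitivity (\int[lam]_m h (m + - (x * y / (a ^+ 2 + x ^+ 2)))%R)%E.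
  apply: eq_integral => m _; congr EFin; rewrite /kappa.
  rewrite -[a in LHS]invrK -invfM invrK; congr (_^-1).
  by rewrite /al /ga; field; rewrite !gt_eqF.
rewrite (integral_shift _ mh) integral_cauchy//.
congr (_ / Num.sqrt _)%:E.
by rewrite /al /ga; field; rewrite !gt_eqF.
Qed.

End Kernels.

(** * Integrals over product spaces *)

Section ProductIntegrals.
Context d1 d2 (T1 : measurableType d1) (T2 : measurableType d2) (R : realType).
Variable m1 : {sigma_finite_measure set T1 -> \bar R}.
Variable m2 : {sigma_finite_measure set T2 -> \bar R}.
Local Open Scope ereal_scope.

Lemma integrable_tensor (f : T1 -> R) (g : T2 -> R) :
  m1.-integrable setT (EFin \o f) -> m2.-integrable setT (EFin \o g) ->
  (m1 \x m2).-integrable setT (fun z => (f z.1 * g z.2)%:E).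
Proof.
move=> /integrableP[mf jf] /integrableP[mg jg]; apply/integrable12ltyP.
  apply/measurable_EFinP; apply: measurable_funM.
    by apply: measurableT_comp => //; exact/measurable_EFinP.
  by apply: measurableT_comp => //; exact/measurable_EFinP.
have mag : measurable_fun setT (fun y => `|(g y)%:E|) by exact: measurableT_comp.
have maf : measurable_fun setT (fun y => `|(f y)%:E|) by exact: measurableT_comp.
rewrite (eq_integral (fun x => `|(f x)%:E| * \int[m2]_y `|(g y)%:E|)); last first.
  move=> x _; rewrite -ge0_integralZl//.
  by apply: eq_integral => y _; rewrite EFinM abseM.
rewrite ge0_integralZr//; last exact: integral_ge0.
by rewrite lte_mul_pinfty// ?integral_ge0// ge0_fin_numE// integral_ge0.
Qed.

(** Unlike the usual statement of Fubini, this asks for no integrability, so it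
    applies to functions of a slope or an intercept that ranges over the whole
    line. *)
Lemma measurable_integral_param (H : T1 * T2 -> \bar R) :
  measurable_fun setT H -> measurable_fun setT (fun y => \int[m1]_x H (x, y)).
Proof.
move=> mH.
rewrite (_ : (fun y => _) = (fun y => \int[m1]_x H^\+ (x, y)) \-
                            (fun y => \int[m1]_x H^\- (x, y))).
  apply: emeasurable_funB.
    by apply: (measurable_fun_fubini_tonelli_G H^\+) => //;
      exact: measurable_funepos.
  by apply: (measurable_fun_fubini_tonelli_G H^\-) => //;
    exact: measurable_funeneg.
apply/funext => y; rewrite integralE; congr (_ - _); apply: eq_integral => x _;
by rewrite ?funeposE ?funenegE.
Qed.

End ProductIntegrals.

Section Bounded.
Context d (T : measurableType d) (R : realType).
Variable mu : {measure set T -> \bar R}.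
Lemma integrable_mul_bounded (f h : T -> R) (K : R) :
  mu.-integrable setT (EFin \o f) -> measurable_fun setT h ->
  (forall x, `|h x| <= K) -> mu.-integrable setT (fun x => (f x * h x)%:E).
Proof.
move=> jf mh hK.
apply: (@integrableMl _ _ _ mu setT measurableT (EFin \o f) h) => //.
exists K; split; first by rewrite num_real.
by move=> M KM x _; exact: (le_trans (hK x) (ltW KM)).
Qed.
End Bounded.

Lemma measurable_fun_invr d (T : measurableType d) (R : realType) (f : T -> R) :
  measurable_fun setT f -> (forall x, 0 <= f x) ->
  measurable_fun setT (fun x => (f x)^-1).
Proof.
move=> mf f0.
rewrite (_ : (fun x => _) = (@powR R ^~ (-1)) \o f).
  by apply: measurableT_comp => //; exact: measurable_powR.
by apply/funext => x; rewrite /= powR_inv1.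
Qed.

Lemma measurable_fun_sqrt d (T : measurableType d) (R : realType) (g : T -> R) :
  measurable_fun setT g -> measurable_fun setT (fun x => Num.sqrt (g x)).
Proof.
move=> mg; apply: (measurableT_comp (f := @Num.sqrt R)) => //.
by apply: continuous_measurable_fun; exact: sqrt_continuous.
Qed.

Lemma integrable_indic_fin d (T : measurableType d) (R : realType)
    (mu : {measure set T -> \bar R}) (A : set T) : measurable A ->
  (mu A < +oo)%E -> mu.-integrable setT (fun x => (\1_A x : R)%:E).
Proof.
move=> mA finA; apply/integrableP; split.
  by apply/measurable_EFinP; exact: measurable_indic.
by under eq_integral do rewrite gee0_abs ?lee_fin//; rewrite integral_indic// setIT.
Qed.

Section SigmaFiniteProduct.
Context d1 d2 (T1 : measurableType d1) (T2 : measurableType d2) (R : realType).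
Variable m1 : {sigma_finite_measure set T1 -> \bar R}.
Variable m2 : {sigma_finite_measure set T2 -> \bar R}.

(** A name of its own for the product gives it the structure of a sigma-finite
    measure, which Fubini needs when products are iterated: the energies are
    integrals over two copies of the plane and a slope. *)
Definition sfprod : set (T1 * T2) -> \bar R := (m1 \x m2)%E.

HB.instance Definition _ := Measure.on sfprod.

Lemma sfprod_sigma_finite : sigma_finite setT sfprod.
Proof.
have [F TF mF] := sigma_finiteT m1; have [G TG mG] := sigma_finiteT m2.
exists (fun n => if (choice.unpickle n : option (nat * nat)) is Some ij
  then F ij.1 `*` G ij.2 else set0).
  apply/seteqP; split => // -[x y] _.
  have [i _ Fx] : (\bigcup_k F k) x by rewrite -TF.
  have [j _ Gy] : (\bigcup_k G k) y by rewrite -TG.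
  by exists (choice.pickle (i, j)) => //; rewrite choice.pickleK.
move=> n; case: (choice.unpickle n : option (nat * nat)) => [[i j]|]; last by rewrite measure0.
have [mFi Fi] := mF i; have [mGj Gj] := mG j.
split; first exact: measurableX.
by rewrite /sfprod product_measure1E//= lte_mul_pinfty// ge0_fin_numE.
Qed.

HB.instance Definition _ :=
  Measure_isSigmaFinite.Build _ _ _ sfprod sfprod_sigma_finite.

End SigmaFiniteProduct.

Definition plane {R : realType} := sfprod (@lebesgue_measure R) (@lebesgue_measure R).
HB.instance Definition _ {R : realType} := SigmaFiniteMeasure.on (@plane R).

(** * Lines of a fixed slope *)

Section Radon.
Context {R : realType}.
Notation lam := (@lebesgue_measure R).
Notation RR := (measurableTypeR R).
Notation lam2 := (lam \x lam)%E.
Implicit Types (f : RR * RR -> R) (m : R).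

Lemma measurable_shear m :
  measurable_fun [set: RR * RR] (fun z : RR * RR => (z.1, z.2 + m * z.1) : RR * RR).
Proof.
apply: measurable_fun_pair => //; apply: measurable_funD => //.
exact: measurable_funM.
Qed.

Section one_direction.
Variables (f : RR * RR -> R) (m : R).
Hypothesis jf : lam2.-integrable setT (EFin \o f).

Let mf : measurable_fun setT f.
Proof. by apply/measurable_EFinP; exact: measurable_int jf. Qed.

Let mg : measurable_fun [set: RR * RR] (fun z : RR * RR => f (z.1, z.2 + m * z.1)).
Proof. by apply: (measurableT_comp mf); exact: measurable_shear. Qed.

Lemma integrable_shear (phi : RR -> R) (K : R) : measurable_fun setT phi ->
  (forall b, `|phi b| <= K) ->
  lam2.-integrable setT
    (fun z : RR * RR => (f (z.1, z.2 + m * z.1) * phi z.2)%:E).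
Proof.
move=> mphi phiK; apply/integrable12ltyP.
  by apply/measurable_EFinP; apply: measurable_funM => //; exact: measurableT_comp.
have jfp : lam2.-integrable setT
    (fun z : RR * RR => (f z * phi (z.2 - m * z.1))%:E).
  apply: (@integrable_mul_bounded _ _ _ _ _ _ K) => //.
  apply: measurableT_comp => //.
  by apply: measurable_funB => //; exact: measurable_funM.
have mfp := measurable_int _ jfp.
move/(integrable12ltyP _ _ mfp) : jfp; apply: le_lt_trans.
rewrite le_eqVlt; apply/orP; left; apply/eqP; apply: eq_integral => x _ /=.
have mh : measurable_fun [set: RR]
    (fun y => `|(f (x, y) * phi (y - m * x))%:E|%E).
  apply: measurableT_comp => //.
  exact: (measurableT_comp mfp (pair1_measurable x)).
rewrite -(ge0_integral_shift (m * x) mh)//.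
by apply: eq_integral => b _; rewrite addrK.
Qed.

(** Slicing the plane into the lines of slope m, which (b, x) |->
    (x, b + m * x) does without changing areas: multiplying f by a function of
    the intercept alone weights its line integrals. *)
Lemma integral_shear (phi : RR -> R) (K : R) : measurable_fun setT phi ->
  (forall b, `|phi b| <= K) ->
  (\int[lam2]_p (f p * phi (p.2 - m * p.1)%R)%:E =
   \int[lam]_b \int[lam]_x (f (x, b + m * x)%R * phi b)%:E)%E.
Proof.
move=> mphi phiK.
have jfp : lam2.-integrable setT
    (fun z : RR * RR => (f z * phi (z.2 - m * z.1))%:E).
  apply: (@integrable_mul_bounded _ _ _ _ _ _ K) => //.
  apply: measurableT_comp => //.
  by apply: measurable_funB => //; exact: measurable_funM.
have mfp := measurable_int _ jfp.
rewrite -(integral12_prod_meas1 jfp).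
have := Fubini (integrable_shear mphi phiK).
rewrite /fubini_F /fubini_G/= => <-.
apply: eq_integral => x _ /=.
have mh : measurable_fun [set: RR] (fun y => (f (x, y) * phi (y - m * x))%:E).
  exact: (measurableT_comp mfp (pair1_measurable x)).
rewrite -(integral_shift (m * x) mh)//.
by apply: eq_integral => b _; rewrite addrK.
Qed.

Lemma ae_integrable_section :
  {ae lam, forall b, lam.-integrable setT (fun x => (f (x, b + m * x))%:E)}.
Proof.
have mc : measurable_fun [set: RR] (cst 1 : RR -> R) by [].
have c1 (b : RR) : `|(cst 1 : RR -> R) b| <= 1 by rewrite /= normr1.
have /ae_integrable2 := integrable_shear mc c1.
by apply: filterS => b /=; under eq_fun do rewrite mulr1.
Qed.

End one_direction.
End Radon.

Section Direction.
Context {R : realType}.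
Notation lam := (@lebesgue_measure R).
Notation RR := (measurableTypeR R).
Notation lam2 := (lam \x lam)%E.

Lemma measurable_intercept (m : R) :
  measurable_fun [set: RR * RR] (fun z : RR * RR => z.2 - m * z.1).
Proof. by apply: measurable_funB => //; exact: measurable_funM. Qed.

Section bound.
Variables (f : RR * RR -> R) (m e r c K I : R) (k : RR -> R).
Hypothesis jf : lam2.-integrable setT (EFin \o f).
Hypothesis supp : forall x b, f (x, b + m * x) != 0 -> `|b - c| <= r.
Hypothesis thin :
  {ae lam, forall b, (`|\int[lam]_x (f (x, b + m * x)%R)%:E| <= e%:E)%E}.
Hypotheses (e0 : 0 <= e) (r0 : 0 <= r) (I0 : 0 <= I).
Hypothesis mk : measurable_fun setT k.
Hypothesis k0 : forall s, 0 <= k s.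
Hypothesis kK : forall s, k s <= K.
Hypothesis kI : forall b, (\int[lam]_s (k (s - b)%R)%:E <= I%:E)%E.

Let mf : measurable_fun setT f.
Proof. by apply/measurable_EFinP; exact: measurable_int jf. Qed.

Let mkb b : measurable_fun [set: RR] (fun s => k (s - b)).
Proof. by apply: measurableT_comp => //; exact: measurable_funB. Qed.

Let kKb b s : `|k (s - b)| <= K.
Proof. by rewrite ger0_norm. Qed.

Let mshear (phi : RR -> R) : measurable_fun setT phi ->
  measurable_fun setT (fun b : RR => \int[lam]_x (f (x, b + m * x)%R * phi b)%:E)%E.
Proof.
move=> mphi.
apply: (@measurable_integral_param _ _ RR RR R lam
  (fun z : RR * RR => (f (z.1, z.2 + m * z.1) * phi z.2)%:E)).
apply/measurable_EFinP; apply: measurable_funM.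
  by apply: (measurableT_comp mf); exact: measurable_shear.
exact: measurableT_comp.
Qed.

Let thin_phi (phi : RR -> R) : {ae lam, forall b,
  (`|\int[lam]_x (f (x, b + m * x)%R * phi b)%:E| <= (e * `|phi b|)%:E)%E}.
Proof.
move: thin (ae_integrable_section m jf); apply: filterS2.
  exact: (ae_filter_ringOfSetsType lam).
move=> b /= tb jb.
under eq_integral do rewrite EFinM.
by rewrite integralZr// abseM EFinM lee_wpmul2r.
Qed.

(* The inner integral depends on p through its intercept b only. *)
Let phi0 (b : RR) : \bar R := (\int[lam2]_q (f q * k (q.2 - m * q.1 - b)%R)%:E)%E.

Let phi0_le b : (`|phi0 b| <= (e * I)%:E)%E.
Proof.
rewrite /phi0 (integral_shear m jf (mkb b) (kKb b)).
apply: le_trans; first by apply: le_abse_integral => //; exact: mshear.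
apply: (@le_trans _ _ (\int[lam]_s (e * k (s - b))%:E)%E).
  apply: ae_ge0_le_integral => //.
  - by apply: measurableT_comp => //; exact: mshear.
  - by move=> s _; rewrite lee_fin mulr_ge0.
  - by apply/measurable_EFinP; exact: measurable_funM.
  move: (thin_phi (fun s => k (s - b))); apply: filterS.
    exact: (ae_filter_ringOfSetsType lam).
  by move=> s; rewrite (ger0_norm (k0 _)).
under eq_integral do rewrite EFinM.
rewrite ge0_integralZl//.
- by rewrite EFinM lee_wpmul2l.
- by apply/measurable_EFinP.
- by move=> s _; rewrite lee_fin.
Qed.

Let phi b : R := fine (phi0 b).

Let phi0E b : phi0 b = (phi b)%:E.
Proof.
by rewrite /phi fineK// fin_num_abs (le_lt_trans (phi0_le b))// ltry.
Qed.

Let mphi : measurable_fun setT phi.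
Proof.
have -> : phi = fine \o phi0 by [].
apply: (measurableT_comp (f := fine)); first exact: fine_measurable.
have := (@measurable_integral_param _ _ (RR * RR)%type RR R plane
  (fun z : (RR * RR) * RR => (f z.1 * k (z.1.2 - m * z.1.1 - z.2))%:E)).
apply.
apply/measurable_EFinP; apply: measurable_funM; first exact: measurableT_comp.
apply: measurableT_comp => //; apply: measurable_funB => //.
by apply: (measurableT_comp (measurable_intercept m)).
Qed.

Let phi_le b : `|phi b| <= e * I.
Proof. by rewrite -lee_fin; have := phi0_le b; rewrite phi0E. Qed.

(** Two applications of integral_shear turn the double integral into
    the quadratic form with kernel k in the line integrals of f.  These are at
    most e and live on an interval of length 2 * r, and k has integral at most
    I. *)
Lemma direction_bound :
  (`|\int[lam2]_p \int[lam2]_q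
     (f p * f q * k ((q.2 - m * q.1) - (p.2 - m * p.1))%R)%:E|
   <= (2 * r * e ^+ 2 * I)%:E)%E.
Proof.
rewrite (eq_integral (fun p => (f p * phi (p.2 - m * p.1))%:E)); last first.
  move=> p _.
  under eq_integral do rewrite -mulrA EFinM.
  rewrite integralZl//; first by rewrite EFinM -phi0E.
  apply: (@integrable_mul_bounded _ _ _ _ _ _ K) => //.
  apply: (measurableT_comp (mkb _)); exact: measurable_intercept.
rewrite (integral_shear m jf mphi phi_le).
apply: le_trans; first by apply: le_abse_integral => //; exact: mshear.
pose J : set RR := `[c - r, c + r]%classic.
have mJ : measurable J by exact: measurable_itv.
apply: (@le_trans _ _ (\int[lam]_b ((e ^+ 2 * I)%:E * (\1_J b)%:E))%E).
  apply: ae_ge0_le_integral => //.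
  - by apply: measurableT_comp => //; exact: mshear.
  - by move=> s _; rewrite -EFinM lee_fin mulr_ge0// mulr_ge0// sqr_ge0.
  - by apply: measurable_funeM; apply/measurable_EFinP.
  move: (thin_phi phi); apply: filterS.
    exact: (ae_filter_ringOfSetsType lam).
  move=> b tb _.
  rewrite indicE; have [bJ|bJ] := boolP (b \in J).
    rewrite mule1 (le_trans tb)// lee_fin expr2 -mulrA ler_wpM2l//.
  rewrite mule0 integral0_eq ?abse0// => x _.
  have [->|/supp] := eqVneq (f (x, b + m * x)) 0; first by rewrite mul0r.
  move=> bc; exfalso; move/negP : bJ; apply; rewrite inE /J/= in_itv/=.
  by move: bc; rewrite ler_norml lerBlDl lerBrDl.
rewrite ge0_integralZl//; last 2 first.
- by apply/measurable_EFinP.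
- by rewrite lee_fin mulr_ge0// sqr_ge0.
rewrite integral_indic// setIT [X in (_ * X <= _)%E]lebesgue_measure_itv/= lte_fin.
case: ifPn => [_|_]; last by rewrite mule0 lee_fin !mulr_ge0// sqr_ge0.
by rewrite -EFinB -EFinM lee_fin le_eqVlt; apply/orP; left; apply/eqP; ring.
Qed.

End bound.
End Direction.

(** * The energy is controlled by the line integrals *)

Section Energy.
Context {R : realType}.
Notation lam := (@lebesgue_measure R).
Notation RR := (measurableTypeR R).
Notation P := (@plane R).

(** The Riesz kernel 1 / |v| of the plane, smoothed at scale a.  Its energy is
    the natural quadratic form here, because integrating the squares of the
    line integrals over all lines produces the kernel 1 / |v|. *)
Definition riesz (a : R) (v : R * R) : R :=
  (Num.sqrt (a ^+ 2 + v.1 ^+ 2 + v.2 ^+ 2))^-1.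

Lemma riesz_den_ge (a : R) (v : R * R) : 0 < a ->
  a <= Num.sqrt (a ^+ 2 + v.1 ^+ 2 + v.2 ^+ 2).
Proof.
move=> a0; rewrite -[leLHS](gtr0_norm a0) -sqrtr_sqr ler_wsqrtr// -addrA lerDl.
by rewrite addr_ge0// sqr_ge0.
Qed.

Lemma riesz_ge0 (a : R) v : 0 <= riesz a v.
Proof. by rewrite invr_ge0 sqrtr_ge0. Qed.

Lemma riesz_le (a : R) v : 0 < a -> riesz a v <= a^-1.
Proof.
by move=> a0; rewrite lef_pV2 ?posrE// ?riesz_den_ge// (lt_le_trans a0)// riesz_den_ge.
Qed.

Lemma measurable_riesz (a : R) : measurable_fun [set: RR * RR] (riesz a).
Proof.
apply: measurable_fun_invr; last by move=> v; exact: sqrtr_ge0.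
apply: measurable_fun_sqrt; apply: measurable_funD; last exact: measurable_funX.
by apply: measurable_funD => //; exact: measurable_funX.
Qed.

Lemma measurable_kappa d (T : measurableType d) (a : R) (g h : T -> R) : 0 < a ->
  measurable_fun setT g -> measurable_fun setT h ->
  measurable_fun setT (fun x => kappa a (g x) (h x)).
Proof.
move=> a0 mg mh; apply: measurable_funM => //.
apply: measurable_fun_invr; last by move=> x; exact/ltW/kappa_den_gt0.
apply: measurable_funD; last exact: measurable_funX.
apply: measurable_funM => //; apply: measurable_funD => //.
exact: measurable_funX.
Qed.

Definition vdiff (z : (RR * RR) * (RR * RR)) : RR * RR :=
  (z.2.1 - z.1.1, z.2.2 - z.1.2).

Lemma measurable_vdiff : measurable_fun setT vdiff.
Proof.
apply: measurable_fun_pair; apply: measurable_funB; exact: measurableT_comp.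
Qed.

Section bound.
Variables (f : RR * RR -> R) (a rho eps : R) (p0 : R * R).
Hypotheses (a0 : 0 < a) (rho0 : 0 <= rho) (eps0 : 0 <= eps).
Hypothesis jf : P.-integrable setT (EFin \o f).
Hypothesis supp : forall p, f p != 0 ->
  (p.1 - p0.1) ^+ 2 + (p.2 - p0.2) ^+ 2 <= rho ^+ 2.
Hypothesis thin : forall m, {ae lam, forall b,
  (`|\int[lam]_x (f (x, b + m * x)%R)%:E| <= (eps / Num.sqrt (1 + m ^+ 2))%:E)%E}.

Let mf : measurable_fun setT f.
Proof. by apply/measurable_EFinP; exact: measurable_int jf. Qed.

Let X := sfprod (@plane R) (@plane R).

Let ff (z : (RR * RR) * (RR * RR)) : R := f z.1 * f z.2.

Lemma integrable_square :
  (sfprod P P).-integrable setT (EFin \o (fun z => f z.1 * f z.2)).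
Proof. exact: (integrable_tensor jf jf). Qed.

Let mff : measurable_fun setT ff.
Proof. by apply/measurable_EFinP; exact: measurable_int integrable_square. Qed.

Let H (w : ((RR * RR) * (RR * RR)) * RR) : R :=
  ff w.1 * kappa a w.2 ((vdiff w.1).2 - w.2 * (vdiff w.1).1).

Let mH : measurable_fun setT H.
Proof.
apply: measurable_funM; first exact: measurableT_comp.
apply: measurable_kappa => //.
have mv : measurable_fun [set: ((RR * RR) * (RR * RR)) * RR] (fun w => vdiff w.1).
  by apply: measurableT_comp => //; exact: measurable_vdiff.
apply: measurable_funB; first exact: (measurableT_comp _ mv).
by apply: measurable_funM => //; exact: (measurableT_comp _ mv).
Qed.

Let kslope z : (\int[lam]_m (kappa a m ((vdiff z).2 - m * (vdiff z).1))%:E =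
  (pi * riesz a (vdiff z))%:E)%E.
Proof. exact: integral_kappa_slope. Qed.

Let mkm z : measurable_fun [set: RR]
  (fun m => kappa a m ((vdiff z).2 - m * (vdiff z).1)).
Proof.
by apply: measurable_kappa => //; apply: measurable_funB => //; exact: measurable_funM.
Qed.

Let jk z : lam.-integrable setT
  (fun m => (kappa a m ((vdiff z).2 - m * (vdiff z).1))%:E).
Proof.
apply/integrableP; split; first exact/measurable_EFinP.
under eq_integral do rewrite abse_EFin ger0_norm ?kappa_ge0//.
by rewrite kslope ltry.
Qed.

Let pi_riesz_le z : `|pi * riesz a (vdiff z)| <= pi * a^-1.
Proof.
by rewrite ger0_norm ?mulr_ge0 ?pi_ge0 ?riesz_ge0// ler_wpM2l ?pi_ge0// riesz_le.
Qed.

Let mriesz : measurable_fun setT (fun z => pi * riesz a (vdiff z)).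
Proof.
apply: measurable_funM => //; apply: measurableT_comp; first exact: measurable_riesz.
exact: measurable_vdiff.
Qed.

Let jH : (X \x lam)%E.-integrable setT (EFin \o H).
Proof.
apply/integrable12ltyP; first exact/measurable_EFinP.
rewrite (eq_integral (fun z => `|(ff z * (pi * riesz a (vdiff z)))%:E|)%E); last first.
  move=> z _.
  transitivity (`|ff z|%:E *
      \int[lam]_m (kappa a m ((vdiff z).2 - m * (vdiff z).1))%:E)%E.
    rewrite -ge0_integralZl//.
    + by apply: eq_integral => m _; rewrite /H/= (normrM (ff z)) (ger0_norm (kappa_ge0 _ _ a0)).
    + exact/measurable_EFinP.
    + by move=> m _; rewrite lee_fin kappa_ge0.
  by rewrite kslope -EFinM /= (normrM (ff z)) (@ger0_norm _ (pi * _)) ?mulr_ge0 ?pi_ge0 ?riesz_ge0.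
have := integrable_mul_bounded integrable_square mriesz pi_riesz_le.
by move=> /integrableP[].
Qed.

(** In terms of x the line of slope m is traversed at speed sqrt (1 + m ^ 2),
    whence the bound eps / sqrt (1 + m ^ 2) in the hypothesis; a disc of radius
    rho meets the lines of slope m whose intercepts fill an interval of
    half-length rho * sqrt (1 + m ^ 2).  The powers of sqrt (1 + m ^ 2) combine
    to (1 + m ^ 2)^-1, whose integral over all slopes is pi, and the bound does
    not depend on a. *)
Lemma energy_bound :
  (`|\int[sfprod P P]_z (f z.1 * f z.2 * riesz a (vdiff z))%:E|
     <= (2 * pi * rho * eps ^+ 2)%:E)%E.
Proof.
change (`|\int[X]_z (ff z * riesz a (vdiff z))%:E|
  <= (2 * pi * rho * eps ^+ 2)%:E)%E.
have pi0 := pi_gt0 R.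
have slope (z : (RR * RR) * (RR * RR)) :
    (\int[lam]_m (H (z, m))%:E = (ff z * (pi * riesz a (vdiff z)))%:E)%E.
  by rewrite (EFinM (ff z)) -kslope -(integralZl measurableT (jk z)).
have E : (\int[X]_z (ff z * (pi * riesz a (vdiff z)))%:E =
          \int[lam]_m \int[X]_z (H (z, m))%:E)%E.
  rewrite -(Fubini jH); apply: eq_integral => z _.
  by rewrite /fubini_F slope.
have D m : (`|\int[X]_z (H (z, m))%:E| <=
     (2 * pi * rho * eps ^+ 2 * (1 + m ^+ 2)^-1)%:E)%E.
  pose s := Num.sqrt (1 + m ^+ 2).
  have s0 : 0 < s by rewrite sqrtr_gt0 one_plus_sqr_gt0.
  have s2 : s ^+ 2 = 1 + m ^+ 2 by rewrite sqr_sqrtr// ltW// one_plus_sqr_gt0.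
  have jHm : X.-integrable setT (fun z => (H (z, m))%:E).
    apply: (@integrable_mul_bounded _ _ _ _ _ _ a^-1 integrable_square).
      apply: measurable_kappa => //.
      apply: measurable_funB; first exact: (measurableT_comp _ measurable_vdiff).
      by apply: measurable_funM => //; exact: (measurableT_comp _ measurable_vdiff).
    by move=> z; rewrite ger0_norm ?kappa_ge0// kappa_le.
  rewrite -(integral12_prod_meas1 jHm).
  have supp' x b : f (x, b + m * x) != 0 ->
      `|b - (p0.2 - m * p0.1)| <= rho * s.
    move=> /supp/= fxb.
    have rs0 : 0 <= rho * s by rewrite mulr_ge0// ltW.
    rewrite -[leRHS]ger0_norm// -ler_sqr ?nnegrE// real_normK ?num_real//.
    rewrite ger0_norm// exprMn s2.
    (* Cauchy-Schwarz for the vectors (x - p0.1, b + m * x - p0.2) and (- m, 1) *)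
    apply: (@le_trans _ _ (((x - p0.1) ^+ 2 + (b + m * x - p0.2) ^+ 2) * (1 + m ^+ 2)));
      last by rewrite ler_wpM2r// ltW// one_plus_sqr_gt0.
    rewrite -subr_ge0 [leRHS](_ : _ =
      (x - p0.1 + m * (b + m * x - p0.2)) ^+ 2) ?sqr_ge0//.
    by ring.
  have kI b : (\int[lam]_t (kappa a m (t - b))%:E <= (pi / s)%:E)%E.
    by rewrite integral_kappa.
  have es0 : 0 <= eps / s by rewrite divr_ge0// ltW.
  have rs0 : 0 <= rho * s by rewrite mulr_ge0// ltW.
  have ps0 : 0 <= pi / s by rewrite divr_ge0// ltW.
  have mk : measurable_fun [set: RR] (kappa a m) by exact: measurable_kappa.
  have := @direction_bound R f m (eps / s) (rho * s) _ a^-1 (pi / s) (kappa a m)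
    jf supp' (thin m) es0 rs0 ps0 mk (fun t => kappa_ge0 m t a0)
    (fun t => kappa_le m t a0) kI.
  have -> : 2 * (rho * s) * (eps / s) ^+ 2 * (pi / s) =
    2 * pi * rho * eps ^+ 2 * (1 + m ^+ 2)^-1.
    by rewrite -s2; field; rewrite gt_eqF.
  apply: le_trans; rewrite le_eqVlt; apply/orP; left; apply/eqP.
  congr (`|_|)%E; apply: eq_integral => p _; apply: eq_integral => q _.
  by rewrite /H /ff /vdiff/=; congr (_ * kappa a m _)%:E; ring.
have jU : X.-integrable setT (fun z => (ff z * riesz a (vdiff z))%:E).
  apply: (@integrable_mul_bounded _ _ _ _ _ _ a^-1 integrable_square).
    by apply: measurableT_comp; [exact: measurable_riesz|exact: measurable_vdiff].
  by move=> z; rewrite ger0_norm ?riesz_ge0// riesz_le.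
have piU : (\int[X]_z (ff z * (pi * riesz a (vdiff z)))%:E =
    pi%:E * \int[X]_z (ff z * riesz a (vdiff z))%:E)%E.
  rewrite -(integralZl measurableT jU); apply: eq_integral => z _.
  by rewrite -EFinM; congr EFin; ring.
rewrite -(lee_pmul2l (_ : pi%:E \is a fin_num)%E) ?lte_fin//.
rewrite -[X in (X * `|_| <= _)%E]gee0_abs ?lee_fin ?pi_ge0// -abseM -piU E.
have mHX : measurable_fun [set: RR] (fun m => \int[X]_z (H (z, m))%:E)%E.
  apply: (@measurable_integral_param _ _ _ RR R X (fun w => (H w)%:E)).
  exact/measurable_EFinP.
apply: le_trans; first by apply: le_abse_integral => //.
pose C := 2 * pi * rho * eps ^+ 2.
have C0 : 0 <= C by rewrite !mulr_ge0 ?pi_ge0 ?sqr_ge0.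
have mc : measurable_fun [set: RR] (fun m => (1 + m ^+ 2)^-1).
  apply: measurable_fun_invr; last by move=> m; apply: ltW; exact: one_plus_sqr_gt0.
  by apply: measurable_funD => //; exact: measurable_funX.
have c0 (m : R) : 0 <= (1 + m ^+ 2)^-1 by rewrite invr_ge0 ltW// one_plus_sqr_gt0.
apply: (@le_trans _ _ (\int[lam]_m (C%:E * ((1 + m ^+ 2)^-1)%:E))%E).
  apply: ge0_le_integral => //.
  - exact: measurableT_comp.
  - by apply: measurable_funeM; exact/measurable_EFinP.
rewrite ge0_integralZl//; last 2 first.
- exact/measurable_EFinP.
- by move=> m _; rewrite lee_fin.
rewrite (eq_integral (fun m : RR => ((1 * m ^+ 2 + 1)^-1)%:E)); last first.
  by move=> m _; rewrite mul1r addrC.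
by rewrite integral_cauchy// mulr1 sqrtr1 divr1 -!EFinM mulrC.
Qed.

End bound.
End Energy.

(** * Energy in terms of the autocorrelation *)

Section Translation.
Context {R : realType}.
Notation lam := (@lebesgue_measure R).
Notation RR := (measurableTypeR R).
Notation P := (@plane R).

(** Addition of vectors, spelled out on coordinates so that its measurability
    follows from that of the projections. *)
Definition vadd (p v : RR * RR) : RR * RR := (p.1 + v.1, p.2 + v.2).

Lemma vadd_add p v w : vadd p (v + w) = vadd (vadd p v) w.
Proof. by rewrite /vadd/= !addrA. Qed.

Lemma vaddAC p v w : vadd (vadd p v) w = vadd (vadd p w) v.
Proof. by rewrite /vadd/= ![_ + v.1 + _]addrAC ![_ + v.2 + _]addrAC. Qed.

Lemma measurable_vadd v : measurable_fun setT (vadd ^~ v).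
Proof. by apply: measurable_fun_pair; exact: measurable_funD. Qed.

Lemma measurable_vadd2 :
  measurable_fun setT (fun z : (RR * RR) * (RR * RR) => vadd z.1 z.2).
Proof. by apply: measurable_fun_pair; apply: measurable_funD; exact: measurableT_comp. Qed.

Lemma ge0_integral_vadd (v : RR * RR) (F : RR * RR -> \bar R) :
  measurable_fun setT F -> (forall p, (0 <= F p)%E) ->
  (\int[P]_p F (vadd p v) = \int[P]_p F p)%E.
Proof.
move=> mF F0.
have mFv : measurable_fun setT (fun p => F (vadd p v)).
  by apply: (measurableT_comp mF); exact: measurable_vadd.
rewrite (fubini_tonelli1 (m1 := lam) (m2 := lam) _ mFv)//.
rewrite (fubini_tonelli1 (m1 := lam) (m2 := lam) _ mF)// /fubini_F.
have mF1 := measurable_fun_fubini_tonelli_F (m2 := lam) F mF F0.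
rewrite -(ge0_integral_shift v.1 mF1); last by move=> x; exact: integral_ge0.
apply: eq_integral => x _.
have mFx : measurable_fun [set: RR] (fun y => F (x + v.1, y)).
  exact: (measurableT_comp mF (pair1_measurable _)).
exact: (ge0_integral_shift v.2 mFx (fun y => F0 _)).
Qed.

Lemma integral_vadd (v : RR * RR) (F : RR * RR -> \bar R) :
  measurable_fun setT F ->
  (\int[P]_p F (vadd p v) = \int[P]_p F p)%E.
Proof.
move=> mF; rewrite [LHS]integralE [RHS]integralE.
have := @ge0_integral_vadd v (F^\+)%E (measurable_funepos mF) (funepos_ge0 F).
have := @ge0_integral_vadd v (F^\-)%E (measurable_funeneg mF) (funeneg_ge0 F).
move=> <- <-; congr (_ - _)%E; apply: eq_integral => x _;
by rewrite ?funeposE ?funenegE.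
Qed.

(** The change of variables q = p + v.  The integrability of the right-hand
    side in v is recorded because it is later compared from below with another
    integral over v. *)
Lemma integral_autocorrelation (f k : RR * RR -> R) (K : R) :
  P.-integrable setT (EFin \o f) -> measurable_fun setT k ->
  (forall v, `|k v| <= K) ->
  P.-integrable setT (fun v => \int[P]_p (f p * f (vadd p v) * k v)%:E)%E /\
  (\int[sfprod P P]_z (f z.1 * f z.2 * k (vdiff z))%:E =
   \int[P]_v \int[P]_p (f p * f (vadd p v) * k v)%:E)%E.
Proof.
move=> jf mk kK.
have mf : measurable_fun setT f.
  by apply/measurable_EFinP; exact: measurable_int jf.
have j1 : (sfprod P P).-integrable setT (fun z => (f z.1 * f z.2 * k (vdiff z))%:E).
  apply: (@integrable_mul_bounded _ _ _ _ _ _ K (integrable_square jf)) => //.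
  by apply: (measurableT_comp mk); exact: measurable_vdiff.
have m1 := measurable_int _ j1.
have mh : measurable_fun setT
  (fun z : (RR * RR) * (RR * RR) => (f z.1 * f (vadd z.1 z.2) * k z.2)%:E).
  apply/measurable_EFinP; apply: measurable_funM; last exact: measurableT_comp.
  apply: measurable_funM; first exact: measurableT_comp.
  by apply: (measurableT_comp mf); exact: measurable_vadd2.
have vK p q : vadd p (vadd q (- p.1, - p.2)) = q.
  by rewrite /vadd/= ![p.1 + _]addrC ![p.2 + _]addrC !subrK -surjective_pairing.
have j2 : (P \x P)%E.-integrable setT
  (fun z : (RR * RR) * (RR * RR) => (f z.1 * f (vadd z.1 z.2) * k z.2)%:E).
  apply/(integrable12ltyP _ _ mh).
  move/(integrable12ltyP _ _ m1) : j1; apply: le_lt_trans.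
  rewrite le_eqVlt; apply/orP; left; apply/eqP; apply: eq_integral => p _ /=.
  have mp : measurable_fun setT
      (fun v => `|(f p * f (vadd p v) * k v)%:E|%E).
    apply: measurableT_comp => //.
    exact: (measurableT_comp mh (pair1_measurable p)).
  rewrite -(ge0_integral_vadd (- p.1, - p.2) mp)//.
  by apply: eq_integral => q _; rewrite vK.
have F2 := Fubini j2; rewrite /fubini_F /fubini_G/= in F2.
split.
  apply/integrableP; split.
    exact: (@measurable_integral_param _ _ _ _ R P _ mh).
  move/(integrable21ltyP _ _ mh) : j2; apply: le_lt_trans.
  apply: ge0_le_integral => //.
  - by apply: measurableT_comp => //; exact: (@measurable_integral_param _ _ _ _ R P _ mh).
  - apply: (@measurable_integral_param _ _ _ _ R P
      (fun z => `|(f z.1 * f (vadd z.1 z.2) * k z.2)%:E|%E)).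
    exact: measurableT_comp.
  move=> v _; apply: le_abse_integral => //.
  exact: (measurableT_comp mh (pair2_measurable v)).
rewrite -F2 -(integral12_prod_meas1 j1); apply: eq_integral => p _ /=.
have mp : measurable_fun setT (fun v => (f p * f (vadd p v) * k v)%:E).
  exact: (measurableT_comp mh (pair1_measurable p)).
rewrite -(integral_vadd (- p.1, - p.2) mp).
by apply: eq_integral => q _; rewrite vK.
Qed.
End Translation.

(** * Disjoint translates: a lower bound for the autocorrelation *)

Section FiniteAlgebra.
Context {R : realType} {T : eqType}.
Implicit Types (s : seq T) (x F : T -> R) (al be : pred T).

Definition at_most_one s al :=
  forall g h, g \in s -> h \in s -> al g -> al h -> g = h.

Lemma sum_at_most_one s al F g : uniq s -> at_most_one s al -> g \in s -> al g ->
  \sum_(h <- s | al h) F h = F g.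
Proof.
move=> us one gs ag; rewrite big_mkcond (bigD1_seq g)//= ag big1_seq ?addr0//.
move=> h /andP[hg hs]; case: ifPn => // ah.
by move: hg; rewrite (one h g)// eqxx.
Qed.

Lemma sum_none s al F : {in s, forall g, ~~ al g} ->
  \sum_(h <- s | al h) F h = 0.
Proof.
move=> none; rewrite big_mkcond big1_seq// => h /andP[_ hs].
by rewrite (negbTE (none h hs)).
Qed.

(** With al and be marking the tile that contains p and the one that contains
    p + v: the product x g * x h of the colours is x g ^ 2 when the two tiles
    agree, and at least - (x g ^ 2 + x h ^ 2) / 2 otherwise.  The coefficients
    3/2, 1/2 and 2 are chosen so that the left-hand side is a sum over single
    tiles whose integral over p is explicit. *)
Lemma product_lower_bound s x al be : uniq s ->
  at_most_one s al -> at_most_one s be ->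
  (3 / 2) * (\sum_(g <- s | al g) x g ^+ 2)
    - (1 / 2) * (\sum_(g <- s | be g) x g ^+ 2)
    - 2 * (\sum_(g <- s | al g && ~~ be g) x g ^+ 2)
  <= (\sum_(g <- s | al g) x g) * (\sum_(g <- s | be g) x g).
Proof.
move=> us onea oneb.
have [/hasP[g gs ag]|/hasPn na] := boolP (has al s); last first.
  rewrite !(sum_none _ na) mul0r mulr0 sub0r [X in _ - 2 * X]sum_none; last first.
    by move=> g gs; rewrite (negbTE (na g gs)).
  by rewrite mulr0 subr0 oppr_le0 mulr_ge0// sumr_ge0// => h _; rewrite sqr_ge0.
rewrite !(sum_at_most_one _ us onea gs ag).
have oneab : at_most_one s (fun g => al g && ~~ be g).
  by move=> h h' hs hs' /andP[ah _] /andP[ah' _]; exact: onea.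
have [/hasP[h hs bh]|/hasPn nb] := boolP (has be s); last first.
  rewrite !(sum_none _ nb) (sum_at_most_one _ us oneab gs); last first.
    by rewrite ag nb.
  by have := sqr_ge0 (x g); lra.
rewrite !(sum_at_most_one _ us oneb hs bh).
have [gh|gh] := eqVneq g h.
  rewrite -gh [X in _ - 2 * X]sum_none; first by rewrite -expr2; lra.
  move=> h' hs'; apply/negP => /andP[ah']; rewrite (onea h' g)// gh.
  by rewrite bh.
rewrite (sum_at_most_one _ us oneab gs); last first.
  rewrite ag/=; apply/negP => bg; move: gh.
  by rewrite (oneb g h)// eqxx.
have := sqr_ge0 (x g + x h); nra.
Qed.

End FiniteAlgebra.

Section Autocorrelation.
Context {R : realType}.
Notation RR := (measurableTypeR R).
Notation P := (@plane R).
Variables (E : set (RR * RR)) (G : seq (R * R)) (x : R * R -> R).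
Hypothesis mE : measurable E.
Hypothesis finE : (P E < +oo)%E.
Hypothesis uG : uniq G.
Hypothesis disj : forall g h p, g \in G -> h \in G ->
  E (vadd p (- g)) -> E (vadd p (- h)) -> g = h.

Definition tiles (p : RR * RR) : R := \sum_(g <- G) x g * \1_E (vadd p (- g)).

Definition escape (v : RR * RR) : set (RR * RR) := E `\` (vadd ^~ v @^-1` E).

Lemma measurable_translate v : measurable (vadd ^~ v @^-1` E : set (RR * RR)).
Proof. by rewrite -[X in measurable X]setTI; apply: measurable_vadd. Qed.

Lemma measurable_escape v : measurable (escape v).
Proof. by apply: measurableD => //; exact: measurable_translate. Qed.

Lemma integrable_indic_translate (A : set (RR * RR)) v : measurable A ->
  (P A < +oo)%E ->
  P.-integrable setT (fun p => (\1_A (vadd p v))%:E) /\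
  (\int[P]_p (\1_A (vadd p v))%:E = P A)%E.
Proof.
move=> mA finA.
have mF : measurable_fun setT (fun p : RR * RR => (\1_A p : R)%:E).
  by apply/measurable_EFinP; exact: measurable_indic.
have mFv : measurable_fun setT (fun p : RR * RR => (\1_A (vadd p v) : R)%:E).
  by apply: (measurableT_comp mF); exact: measurable_vadd.
have I : (\int[P]_p (\1_A (vadd p v))%:E = P A)%E.
  rewrite (ge0_integral_vadd v mF); first by rewrite integral_indic// setIT.
  by move=> p; rewrite lee_fin.
split => //; apply/integrableP; split => //.
by under eq_integral do rewrite gee0_abs ?lee_fin//; rewrite I.
Qed.

Lemma fin_escape v : (P (escape v) < +oo)%E.
Proof.
apply: le_lt_trans finE; apply: le_measure; rewrite ?inE//.
  exact: measurable_escape.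
by move=> p [].
Qed.

Lemma integrable_tiles : P.-integrable setT (EFin \o tiles).
Proof.
rewrite (_ : EFin \o tiles =
  fun p => (\sum_(g <- G) (x g)%:E * (\1_E (vadd p (- g)))%:E)%E).
  apply: integrable_sum => // g _; apply: integrableZl => //.
  by have [] := integrable_indic_translate (- g) mE finE.
by apply/funext => p /=; rewrite -sumEFin.
Qed.

(* The contribution of the tile g to the lower bound of product_lower_bound. *)
Let C g v (p : RR * RR) : \bar R :=
  ((3 / 2)%:E * (\1_E (vadd p (- g)))%:E +
   ((- (1 / 2))%:E * (\1_E (vadd p (- g + v)%R))%:E +
    (- 2)%:E * (\1_(escape v) (vadd p (- g)))%:E))%E.

Let integral_C g v : P.-integrable setT (C g v) /\
  (\int[P]_p C g v p = (fine (P E) - 2 * fine (P (escape v)))%:E)%E.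
Proof.
have [j1 i1] := integrable_indic_translate (- g) mE finE.
have [j2 i2] := integrable_indic_translate (- g + v) mE finE.
have [j3 i3] := integrable_indic_translate (- g) (measurable_escape v) (fin_escape v).
have k1 := integrableZl measurableT (3 / 2) j1.
have k2 := integrableZl measurableT (- (1 / 2)) j2.
have k3 := integrableZl measurableT (- 2) j3.
have k23 := integrableD measurableT k2 k3.
split; first exact: (integrableD measurableT k1 k23).
rewrite (integralD measurableT k1 k23) (integralD measurableT k2 k3).
rewrite (integralZl measurableT j1) (integralZl measurableT j2).
rewrite (integralZl measurableT j3) i1 i2 i3.
have fe := fin_escape v.
rewrite -(@fineK _ (P E)) ?ge0_fin_numE// -(@fineK _ (P (escape v))) ?ge0_fin_numE//.
by rewrite -!EFinM -!EFinD /=; congr EFin; lra.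
Qed.

Let pointwise v p :
  (\sum_(g <- G) (x g ^+ 2)%:E * C g v p <=
   (tiles p * tiles (vadd p v))%:E)%E.
Proof.
pose al g := vadd p (- g) \in E.
pose be g := vadd (vadd p v) (- g) \in E.
have onea : at_most_one G al.
  by move=> g h gG hG; rewrite /al !inE; exact: disj.
have oneb : at_most_one G be.
  by move=> g h gG hG; rewrite /be !inE; exact: disj.
have tilesE q (ga : pred (R * R)) : (forall g, ga g = (vadd q (- g) \in E)) ->
    tiles q = \sum_(g <- G | ga g) x g.
  move=> gaE; rewrite /tiles [RHS]big_mkcond; apply: eq_bigr => g _.
  by rewrite indicE -gaE; case: ifP => _; rewrite ?mulr1 ?mulr0.
rewrite (tilesE p al)// (tilesE _ be)//.
have := product_lower_bound x uG onea oneb; rewrite -lee_fin; apply: le_trans.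
rewrite [X in _ * X - _ - _]big_mkcond [X in _ - _ * X - _]big_mkcond.
rewrite [X in _ - _ - _ * X]big_mkcond !mulr_sumr -!sumrB -sumEFin.
apply: lee_sum => g _; rewrite /C !indicE -!EFinM lee_fin.
rewrite vadd_add -[vadd (vadd p (- g)) v]vaddAC.
have -> : (vadd p (- g) \in escape v) = al g && ~~ be g.
  rewrite /al /be; apply/idP/idP.
    rewrite inE => -[Ep Epv]; rewrite mem_set//=; apply/negP; rewrite inE => Epv'.
    by apply: Epv; rewrite /= vaddAC.
  move=> /andP[]; rewrite inE => Ep; rewrite notin_setE => nE.
  rewrite inE; split => //= Epv; apply: nE.
  by rewrite vaddAC.
rewrite -/(al g) -/(be g).
by case: (al g); case: (be g) => /=; lra.
Qed.

Lemma integrable_tiles_product (v : RR * RR) :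
  P.-integrable setT (fun p => (tiles p * tiles (vadd p v))%:E).
Proof.
have mt : measurable_fun setT tiles.
  by apply/measurable_EFinP; exact: measurable_int integrable_tiles.
pose K := \sum_(g <- G) `|x g|.
have tK p : `|tiles p| <= K.
  rewrite (le_trans (ler_norm_sum _ _ _))// ler_sum// => g _.
  rewrite normrM ler_piMr// indicE.
  by case: (_ \in _); rewrite ?normr1 ?normr0.
apply: (@integrable_mul_bounded _ _ _ _ _ _ K integrable_tiles) => //.
by apply: (measurableT_comp mt); exact: measurable_vadd.
Qed.

(** For a shift v that keeps most of E inside E, the colouring is mostly
    multiplied by itself.  What is lost can be charged to the moved part of
    each tile separately, since a point lies in at most one tile; this is why
    the estimate is uniform in the number of tiles. *)
Lemma autocorrelation_ge (v : RR * RR) :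
  (((\sum_(g <- G) x g ^+ 2) * (fine (P E) - 2 * fine (P (escape v))))%:E <=
  \int[P]_p (tiles p * tiles (vadd p v))%:E)%E.
Proof.
have jt := integrable_tiles_product v.
have jC : P.-integrable setT (fun p => \sum_(g <- G) (x g ^+ 2)%:E * C g v p)%E.
  by apply: integrable_sum => // g _; apply: integrableZl => //; have [] := integral_C g v.
apply: (@le_trans _ _ (\int[P]_p \sum_(g <- G) (x g ^+ 2)%:E * C g v p)%E); last first.
  by apply: le_integral => // p _; exact: pointwise.
rewrite integral_sum//; last first.
  by move=> g; apply: integrableZl => //; have [] := integral_C g v.
rewrite mulr_suml -sumEFin; apply/lee_sum => g _.
have [j i] := integral_C g v.
by rewrite (integralZl measurableT j) i -EFinM.
Qed.

End Autocorrelation.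

(** * Small shifts hardly move a bounded measurable set *)

Section ShiftContinuity.
Context {R : realType}.
Notation lam := (@lebesgue_measure R).
Notation RR := (measurableTypeR R).

Lemma lebesgue_measure_shift (A : set RR) (d : R) : measurable A ->
  lam [set x | A (x + d)] = lam A.
Proof.
move=> mA; have := @lebesgue_measure_affine R 1 d A ltr01 mA.
rewrite invr1 mul1e => <-; congr lebesgue_measure.
by apply/seteqP; split => x /=; rewrite mul1r.
Qed.

Lemma measurable_shift_set (A : set RR) (d : R) : measurable A ->
  measurable ([set x | A (x + d)] : set RR).
Proof.
move=> mA; have mf : measurable_fun [set: RR] (fun x : RR => x + d : RR).
  exact: measurable_funD.
by have := mf measurableT A mA; rewrite setTI.
Qed.

(** A point of an open set stays in it under all small shifts, so dominated
    convergence applies. *)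
Lemma open_shift_cvg (U : set R) (u : R ^nat) : open U -> (lam U < +oo)%E ->
  u @ \oo --> (0 : R) ->
  (lam (U `\` [set x | U (x + u n)%R]) @[n --> \oo] --> 0)%E.
Proof.
move=> oU finU u0.
have mU : measurable (U : set RR) by exact: open_measurable.
have mD n : measurable (U `\` [set x | U (x + u n)] : set RR).
  by apply: measurableD => //; exact: measurable_shift_set.
pose F n (x : RR) : \bar R := (\1_(U `\` [set x | U (x + u n)]) x)%:E.
have jU : lam.-integrable setT (fun x : RR => (\1_U x : R)%:E).
  exact: integrable_indic_fin.
rewrite (_ : (fun n => _) = (fun n => \int[lam]_x F n x)%E); last first.
  by apply/funext => n; rewrite /F integral_indic ?setIT.
rewrite -[X in _ --> X](@integral0 _ _ _ lam setT).
apply: (@dominated_cvg _ _ _ lam setT measurableT F (cst 0%E)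
  (fun x : RR => (\1_U x : R)%:E)) => //.
- by move=> n; apply/measurable_EFinP; exact: measurable_indic.
- move=> x _; have [Ux|nUx] := pselect (U x); last first.
    apply: cvg_near_cst; apply: nearW => n.
    by rewrite /F indicE memNset// => -[].
  apply: cvg_near_cst.
  have : x + u n @[n --> \oo] --> x + 0 by apply: cvgD => //; exact: cvg_cst.
  rewrite addr0 => /(_ U) H.
  have Hx : nbhs x U by apply: open_nbhs_nbhs; split.
  have : \forall n \near \oo, U (x + u n) by exact: (H Hx).
  by apply: filterS => n Un; rewrite /F indicE memNset// => -[].
- move=> n x _; rewrite /F gee0_abs ?lee_fin//.
  rewrite !indicE ler_nat; have [xU|] := boolP (x \in U).
    exact: leq_b1.
  by rewrite notin_setE => nU; rewrite memNset// => -[].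
Qed.

(** Enclose D in an open set U of almost the same measure: a point of D that
    leaves D either leaves U or lands in the small set U minus D. *)
Lemma shift_cvg (D : set RR) (u : R ^nat) : measurable D -> (lam D < +oo)%E ->
  u @ \oo --> (0 : R) ->
  (lam (D `\` [set x | D (x + u n)%R]) @[n --> \oo] --> 0)%E.
Proof.
move=> mD finD u0.
have mDn n : measurable (D `\` [set x | D (x + u n)] : set RR).
  by apply: measurableD => //; exact: measurable_shift_set.
have finDn n : lam (D `\` [set x | D (x + u n)]) \is a fin_num.
  rewrite ge0_fin_numE//; apply: le_lt_trans finD.
  by apply: le_measure; rewrite ?inE// => x [].
apply/fine_cvgP; split; first by apply: nearW => n.
apply/cvgrPdist_le => eps eps0.
have e2 : 0 < eps / 2 by rewrite divr_gt0.
have [U [oU DU UD]] := lebesgue_regularity_outer mD finD e2.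
have mU : measurable (U : set RR) by exact: open_measurable.
have mUD : measurable (U `\` D : set RR) by exact: measurableD.
have finU : (lam U < +oo)%E.
  have -> : U = D `|` (U `\` D) by rewrite setDUK.
  rewrite (le_lt_trans (measureU2 _ _ _))//.
  by rewrite lte_add_pinfty// (lt_trans UD)// ltry.
have /fine_cvgP[_ /cvgrPdist_le/(_ _ e2)] := open_shift_cvg oU finU u0.
apply: filterS => n; rewrite !sub0r !normrN.
rewrite !ger0_norm ?fine_ge0// => Un.
rewrite -lee_fin fineK//.
have mUn : measurable (U `\` [set x | U (x + u n)] : set RR).
  by apply: measurableD => //; exact: measurable_shift_set.
have mUDn := measurable_shift_set (u n) mUD.
apply: (@le_trans _ _ (lam ((U `\` [set x | U (x + u n)]) `|`
    [set x | (U `\` D) (x + u n)]))).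
  apply: le_measure; rewrite ?inE//; first exact: measurableU.
  move=> x [Dx nDx]; have [Ux|nUx] := pselect (U (x + u n)).
    by right.
  by left; split => //; exact: DU.
rewrite (le_trans (measureU2 _ _ _))// [eps]splitr EFinD leeD//.
  rewrite -[X in (X <= _)%E]fineK ?lee_fin//.
  rewrite ge0_fin_numE//; apply: le_lt_trans finU.
  by apply: le_measure; rewrite ?inE// => x [].
apply: (le_trans _ (ltW UD)); rewrite le_eqVlt; apply/orP; left; apply/eqP.
exact: (lebesgue_measure_shift (u n) mUD).
Qed.

End ShiftContinuity.

Section PlaneShiftContinuity.
Context {R : realType}.
Notation lam := (@lebesgue_measure R).
Notation RR := (measurableTypeR R).
Notation P := (@plane R).

Let mEindic (A : set (RR * RR)) : measurable A ->
  measurable_fun setT (fun z => (\1_A z : R)%:E).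
Proof. by move=> mA; apply/measurable_EFinP; exact: measurable_indic. Qed.

Let indic0 (A : set (RR * RR)) z : (0 <= (\1_A z : R)%:E)%E.
Proof. by rewrite lee_fin. Qed.

Let measurable_row (A : set (RR * RR)) y : measurable A ->
  measurable ([set x | A (x, y)] : set RR).
Proof.
by move=> mA; have := pair2_measurable (T1 := RR) y measurableT mA; rewrite setTI.
Qed.

Let measurable_col (A : set (RR * RR)) x : measurable A ->
  measurable ([set y | A (x, y)] : set RR).
Proof.
by move=> mA; have := pair1_measurable (T2 := RR) x measurableT mA; rewrite setTI.
Qed.

Let row_indic (A : set (RR * RR)) y : measurable A ->
  (lam [set x | A (x, y)] = \int[lam]_x (\1_A (x, y) : R)%:E)%E.
Proof.
move=> mA; rewrite -[in LHS](setIT [set x | A (x, y)]) -integral_indic//.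
exact: measurable_row.
Qed.

Let col_indic (A : set (RR * RR)) x : measurable A ->
  (lam [set y | A (x, y)] = \int[lam]_y (\1_A (x, y) : R)%:E)%E.
Proof.
move=> mA; rewrite -[in LHS](setIT [set y | A (x, y)]) -integral_indic//.
exact: measurable_col.
Qed.

Lemma plane_rows (A : set (RR * RR)) : measurable A ->
  measurable_fun setT (fun y : RR => lam [set x | A (x, y)]) /\
  (P A = \int[lam]_y lam [set x | A (x, y)])%E.
Proof.
move=> mA; split.
  rewrite (_ : (fun y => _) = fubini_G lam (fun z => (\1_A z : R)%:E)).
    by apply: measurable_fun_fubini_tonelli_G => //; exact: mEindic.
  by apply/funext => y; rewrite row_indic.
rewrite -[in LHS](setIT A) -integral_indic//.
rewrite (fubini_tonelli2 (m1 := lam) (m2 := lam) _ (mEindic mA))//.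
by apply: eq_integral => y _; rewrite row_indic.
Qed.

Lemma plane_cols (A : set (RR * RR)) : measurable A ->
  measurable_fun setT (fun x : RR => lam [set y | A (x, y)]) /\
  (P A = \int[lam]_x lam [set y | A (x, y)])%E.
Proof.
move=> mA; split.
  rewrite (_ : (fun y => _) = fubini_F lam (fun z => (\1_A z : R)%:E)).
    by apply: measurable_fun_fubini_tonelli_F => //; exact: mEindic.
  by apply/funext => y; rewrite col_indic.
rewrite -[in LHS](setIT A) -integral_indic//.
rewrite (fubini_tonelli1 (m1 := lam) (m2 := lam) _ (mEindic mA))//.
by apply: eq_integral => y _; rewrite col_indic.
Qed.

Variables (E : set (RR * RR)) (M : R).
Hypothesis mE : measurable E.
Hypothesis bE : forall p, E p -> `|p.1| <= M /\ `|p.2| <= M.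

Let J : set RR := `[- M, M]%classic.
Let mJ : measurable J. Proof. exact: measurable_itv. Qed.
Let finJ : (lam J < +oo)%E.
Proof.
rewrite lebesgue_measure_itv/= lte_fin.
by case: ifPn => _; rewrite ?ltry// -EFinB ltry.
Qed.
Let JP (x : R) : `|x| <= M -> J x.
Proof. by rewrite /J/= in_itv/= ler_norml. Qed.

Let jJ : lam.-integrable setT (fun y : RR => lam J * (\1_J y : R)%:E)%E.
Proof.
rewrite -[lam J]fineK ?ge0_fin_numE//; apply: integrableZl => //.
exact: integrable_indic_fin.
Qed.

Lemma fin_bounded : (P E < +oo)%E.
Proof.
apply: (@le_lt_trans _ _ (P (J `*` J))).
  apply: le_measure; rewrite ?inE//; first exact: measurableX.
  by move=> p /bE[p1 p2]; split; exact: JP.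
by rewrite /plane/sfprod product_measure1E//= lte_mul_pinfty// ge0_fin_numE.
Qed.

Let rowE t y : [set x | escape E (t, 0) (x, y)] =
  [set x | E (x, y)] `\` [set x | [set z | E (z, y)] (x + t)].
Proof. by apply/seteqP; split => x; rewrite /escape /vadd/= addr0. Qed.

Let colE t x : [set y | escape E (0, t) (x, y)] =
  [set y | E (x, y)] `\` [set y | [set z | E (x, z)] (y + t)].
Proof. by apply/seteqP; split => y; rewrite /escape /vadd/= addr0. Qed.

(** Horizontal shifts act on each row separately; E being bounded, its rows are
    dominated by an integrable function. *)
Lemma row_escape_cvg (u : R ^nat) : u @ \oo --> (0 : R) ->
  (P (escape E (u n, 0%R)) @[n --> \oo] --> 0)%E.
Proof.
move=> u0.
have mn n := measurable_escape mE (u n, 0).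
rewrite (_ : (fun n => _) = (fun n =>
    \int[lam]_y lam [set x | escape E (u n, 0%R) (x, y)])%E); last first.
  by apply/funext => n; have [] := plane_rows (mn n).
rewrite -[X in _ --> X](@integral0 _ _ _ lam setT).
apply: (@dominated_cvg _ _ _ lam setT measurableT _ (cst 0%E) _ _ _ _ jJ).
- by move=> n; have [] := plane_rows (mn n).
- move=> y _; have mD := measurable_row y mE.
  have finD : (lam [set x | E (x, y)] < +oo)%E.
    apply: le_lt_trans finJ; apply: le_measure; rewrite ?inE//.
    by move=> x /bE[xM _]; exact: JP.
  rewrite (_ : (fun n => _) = (fun n => lam ([set x | E (x, y)] `\`
      [set x | [set z | E (z, y)] (x + u n)%R]))); last first.
    by apply/funext => n; rewrite rowE.
  exact: (shift_cvg mD finD u0).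
- by move=> y _; rewrite fin_numM// ge0_fin_numE.
- move=> n y _; rewrite gee0_abs// indicE; have [yJ|yJ] := boolP (y \in J).
    rewrite mule1; apply: le_measure; rewrite ?inE//; first exact: measurable_row.
    by move=> x [/bE[xM _] _]; exact: JP.
  rewrite mule0 (_ : [set x | _] = set0) ?measure0//.
  apply/seteqP; split => // x [/bE[_ yM] _]; move/negP : yJ; apply.
  by rewrite inE; exact: JP.
Qed.

Lemma col_escape_cvg (u : R ^nat) : u @ \oo --> (0 : R) ->
  (P (escape E (0%R, u n)) @[n --> \oo] --> 0)%E.
Proof.
move=> u0.
have mn n := measurable_escape mE (0, u n).
rewrite (_ : (fun n => _) = (fun n =>
    \int[lam]_x lam [set y | escape E (0%R, u n) (x, y)])%E); last first.
  by apply/funext => n; have [] := plane_cols (mn n).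
rewrite -[X in _ --> X](@integral0 _ _ _ lam setT).
apply: (@dominated_cvg _ _ _ lam setT measurableT _ (cst 0%E) _ _ _ _ jJ).
- by move=> n; have [] := plane_cols (mn n).
- move=> x _; have mD := measurable_col x mE.
  have finD : (lam [set y | E (x, y)] < +oo)%E.
    apply: le_lt_trans finJ; apply: le_measure; rewrite ?inE//.
    by move=> y /bE[_ yM]; exact: JP.
  rewrite (_ : (fun n => _) = (fun n => lam ([set y | E (x, y)] `\`
      [set y | [set z | E (x, z)] (y + u n)%R]))); last first.
    by apply/funext => n; rewrite colE.
  exact: (shift_cvg mD finD u0).
- by move=> y _; rewrite fin_numM// ge0_fin_numE.
- move=> n x _; rewrite gee0_abs// indicE; have [xJ|xJ] := boolP (x \in J).
    rewrite mule1; apply: le_measure; rewrite ?inE//; first exact: measurable_col.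
    by move=> y [/bE[_ yM] _]; exact: JP.
  rewrite mule0 (_ : [set y | _] = set0) ?measure0//.
  apply/seteqP; split => // y [/bE[xM _] _]; move/negP : xJ; apply.
  by rewrite inE; exact: JP.
Qed.

(** A shift is a horizontal shift followed by a vertical one, and a point that
    escapes does so in one of the two steps. *)
Lemma escape_cvg (u v : R ^nat) : u @ \oo --> (0 : R) -> v @ \oo --> (0 : R) ->
  (P (escape E (u n, v n)) @[n --> \oo] --> 0)%E.
Proof.
move=> u0 v0.
apply: (@squeeze_cvge _ _ _ _ (cst 0%E) _
  (fun n => P (escape E (u n, 0%R)) + P (escape E (0%R, v n)))%E).
- apply: nearW => n; rewrite measure_ge0/=.
  have mu := measurable_escape mE (u n, 0); have mv := measurable_escape mE (0, v n).
  have mv' : measurable (vadd ^~ (u n, 0) @^-1` escape E (0, v n)).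
    by rewrite -[X in measurable X]setTI; apply: measurable_vadd.
  apply: (@le_trans _ _ (P (escape E (u n, 0) `|`
      vadd ^~ (u n, 0) @^-1` escape E (0, v n)))).
    apply: le_measure; rewrite ?inE//; [exact: measurable_escape|exact: measurableU|].
    move=> p [Ep nEp]; have [Epu|nEpu] := pselect (E (vadd p (u n, 0))).
      right; split => // Epv; apply: nEp; move: Epv.
      by rewrite /= /vadd/= !addr0.
    by left.
  rewrite (le_trans (measureU2 _ _ _))// leeD2l//.
  have [_ <-] := @integrable_indic_translate R (escape E (0, v n)) (u n, 0) mv
    (fin_escape mE fin_bounded _).
  rewrite -[X in (P X <= _)%E]setIT -integral_indic//.
- exact: cvg_cst.
- rewrite -[X in _ --> X]adde0; apply: cvgeD => //.
  + exact: row_escape_cvg.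
  + exact: col_escape_cvg.
Qed.

End PlaneShiftContinuity.

(** * The gap between two scales is an approximate identity *)

Section RieszGap.
Context {R : realType}.
Notation lam := (@lebesgue_measure R).
Notation RR := (measurableTypeR R).
Notation P := (@plane R).

(** The kernel riesz a alone decays like 1 / |v| and is not integrable on the
    plane; the difference of two scales decays like 1 / |v| ^ 3. *)
Definition riesz_gap (a : R) (v : R * R) : R := riesz a v - riesz (2 * a) v.

Lemma riesz_anti (a b : R) v : 0 < a -> a <= b -> riesz b v <= riesz a v.
Proof.
move=> a0 ab; have b0 : 0 < b by exact: lt_le_trans ab.
rewrite lef_pV2 ?posrE ?(lt_le_trans a0 (riesz_den_ge v a0))//; last first.
  exact: lt_le_trans b0 (riesz_den_ge v b0).
rewrite ler_wsqrtr// !lerD2r ler_sqr ?nnegrE//; exact: ltW.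
Qed.

Lemma riesz_gap_ge0 (a : R) v : 0 < a -> 0 <= riesz_gap a v.
Proof. by move=> a0; rewrite subr_ge0 riesz_anti//; lra. Qed.

Lemma riesz_gap_le (a : R) v : 0 < a -> riesz_gap a v <= a^-1.
Proof.
move=> a0; rewrite (le_trans _ (riesz_le v a0))// gerBl; exact: riesz_ge0.
Qed.

Lemma measurable_riesz_gap (a : R) : measurable_fun [set: RR * RR] (riesz_gap a).
Proof. by apply: measurable_funB; exact: measurable_riesz. Qed.

Lemma riesz_gap_scale (a : R) (w : R * R) : 0 < a ->
  riesz_gap 1 w = a * riesz_gap a (a * w.1, a * w.2).
Proof.
move=> a0.
have rs (b : R) : 0 <= b -> riesz b w = a * riesz (a * b) (a * w.1, a * w.2).
  move=> b0; rewrite /riesz/= !exprMn -!mulrDr sqrtrM ?sqr_ge0// sqrtr_sqr.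
  by rewrite gtr0_norm// invfM mulrA divff ?mul1r// gt_eqF.
have r1 := rs 1 ler01; have r2 := rs 2 (ler0n _ 2).
by rewrite /riesz_gap mulrBr mulr1 r1 r2 mulr1 [2 * a]mulrC.
Qed.

(** With s < t the two square roots, 1 / s - 1 / t = 3 / (s * t * (s + t)), where
    s * t is at least s ^ 2 = 1 + x ^ 2 + y ^ 2 and s + t at least
    2 * sqrt (1 + x ^ 2).  In this form the integrals in y and then in x are both
    instances of integral_cauchy. *)
Lemma riesz_gap1_decay (x y : R) :
  riesz_gap 1 (x, y) <= (3 / 2) / Num.sqrt (1 + x ^+ 2) * (1 * y ^+ 2 + (1 + x ^+ 2))^-1.
Proof.
rewrite /riesz_gap /riesz/= mulr1 mul1r.
have x0 := one_plus_sqr_gt0 x.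
have -> : 1 ^+ 2 + x ^+ 2 + y ^+ 2 = y ^+ 2 + (1 + x ^+ 2) by ring.
have -> : 2 ^+ 2 + x ^+ 2 + y ^+ 2 = y ^+ 2 + (1 + x ^+ 2) + 3 :> R by ring.
set q := y ^+ 2 + (1 + x ^+ 2).
have q0 : 0 < q by rewrite ltr_wpDl ?sqr_ge0.
set s := Num.sqrt q; set t := Num.sqrt (q + 3); set r := Num.sqrt (1 + x ^+ 2).
have q3 : 0 < q + 3 by rewrite addr_gt0.
have s0 : 0 < s by rewrite sqrtr_gt0.
have t0 : 0 < t by rewrite sqrtr_gt0.
have r0 : 0 < r by rewrite sqrtr_gt0.
have s2 : s ^+ 2 = q by rewrite sqr_sqrtr// ltW.
have t2 : t ^+ 2 = q + 3 by rewrite sqr_sqrtr// ltW.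
have rs : r <= s by rewrite ler_wsqrtr// lerDr sqr_ge0.
have st : s <= t by rewrite ler_wsqrtr// lerDl.
have -> : s^-1 - t^-1 = 3 / (s * t * (s + t)).
  have st0 : 0 < s + t by rewrite addr_gt0.
  have -> : 3 = t ^+ 2 - s ^+ 2 by rewrite t2 s2; ring.
  by field; rewrite !gt_eqF.
have -> : 3 / 2 / r * q^-1 = 3 / (2 * r * q).
  by field; rewrite !gt_eqF.
rewrite ler_pM2l// lef_pV2 ?posrE ?mulr_gt0// ?addr_gt0// -s2.
have rt : r <= t := le_trans rs st.
have h1 : s ^+ 2 * r <= s ^+ 2 * t by rewrite ler_wpM2l// sqr_ge0.
have h2 : s * (s * r) <= s * (t * t).
  apply: ler_wpM2l; first exact: ltW.
  by apply: ler_pM => //; exact: ltW.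
by move: h1 h2; rewrite !expr2; lra.
Qed.

Lemma integrable_riesz_gap1 : P.-integrable setT (fun v => (riesz_gap 1 v)%:E).
Proof.
have mb : measurable_fun setT (fun v : RR * RR => (riesz_gap 1 v)%:E).
  by apply/measurable_EFinP; exact: measurable_riesz_gap.
apply/(@integrable12ltyP _ _ RR RR R lam lam _ mb).
have mc : measurable_fun [set: RR] (fun x => (1 + x ^+ 2)^-1).
  apply: measurable_fun_invr; last by move=> x; rewrite ltW// one_plus_sqr_gt0.
  by apply: measurable_funD => //; exact: measurable_funX.
apply: (@le_lt_trans _ _ (\int[lam]_x ((3 / 2 * pi)%:E * ((1 + x ^+ 2)^-1)%:E))%E).
  apply: ge0_le_integral => //.
  - by move=> x _; exact: integral_ge0.
  - apply: (@measurable_fun_fubini_tonelli_F _ _ RR RR R lam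
      (fun z => `|(riesz_gap 1 z)%:E|%E)) => //.
    exact: measurableT_comp.
  - by apply: measurable_funeM; apply/measurable_EFinP.
  move=> x _.
  have x0 := one_plus_sqr_gt0 x.
  have C0 : 0 <= 3 / 2 / Num.sqrt (1 + x ^+ 2) by rewrite divr_ge0// sqrtr_ge0.
  have my : measurable_fun [set: RR] (fun y => (1 * y ^+ 2 + (1 + x ^+ 2))^-1).
    apply: measurable_fun_invr.
      by apply: measurable_funD => //; apply: measurable_funM => //; exact: measurable_funX.
    by move=> y; rewrite mul1r addr_ge0 ?sqr_ge0// ltW.
  apply: (@le_trans _ _ (\int[lam]_y ((3 / 2 / Num.sqrt (1 + x ^+ 2))%:E *
     ((1 * y ^+ 2 + (1 + x ^+ 2))^-1)%:E))%E).
    apply: ge0_le_integral => //.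
    + apply: measurableT_comp => //; exact: (measurableT_comp mb (pair1_measurable x)).
    + by apply: measurable_funeM; apply/measurable_EFinP.
    + move=> y _; rewrite gee0_abs ?lee_fin ?riesz_gap_ge0// riesz_gap1_decay//.
  rewrite ge0_integralZl ?lee_fin//; last 2 first.
  - exact/measurable_EFinP.
  - by move=> y _; rewrite lee_fin invr_ge0 mul1r addr_ge0 ?sqr_ge0// ltW.
  rewrite integral_cauchy// mul1r -!EFinM lee_fin le_eqVlt; apply/orP; left; apply/eqP.
  have s0 : 0 < Num.sqrt (1 + x ^+ 2) by rewrite sqrtr_gt0.
  have s2 : Num.sqrt (1 + x ^+ 2) ^+ 2 = 1 + x ^+ 2 by rewrite sqr_sqrtr// ltW.
  by rewrite -[in RHS]s2; field; rewrite gt_eqF.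
rewrite ge0_integralZl//; last 3 first.
- exact/measurable_EFinP.
- by move=> x _; rewrite lee_fin invr_ge0 ltW// one_plus_sqr_gt0.
- by rewrite lee_fin mulr_ge0 ?pi_ge0.
rewrite (eq_integral (fun m : RR => ((1 * m ^+ 2 + 1)^-1)%:E)); last first.
  by move=> m _; rewrite mul1r addrC.
by rewrite integral_cauchy// -EFinM ltry.
Qed.

(** The kernel is bounded below on the unit square, where |v| ^ 2 is at most
    2. *)
Lemma integral_riesz_gap1_gt0 : (0 < \int[P]_v (riesz_gap 1 v)%:E)%E.
Proof.
pose I : set RR := `[0, 1]%classic.
have mI : measurable I by exact: measurable_itv.
pose c : R := (Num.sqrt 3)^-1 - (2 * 1)^-1.
have c0 : 0 < c.
  have s0 : 0 < Num.sqrt 3 :> R by rewrite sqrtr_gt0.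
  rewrite subr_gt0 mulr1 ltf_pV2 ?posrE//.
  have -> : 2 = Num.sqrt (2 ^+ 2) :> R by rewrite sqrtr_sqr ger0_norm.
  by rewrite ltr_sqrt; lra.
apply: (@lt_le_trans _ _ (\int[P]_v (c%:E * (\1_(I `*` I) v)%:E))%E).
  rewrite ge0_integralZl ?lee_fin ?(ltW c0)//; last first.
    by apply/measurable_EFinP; apply: measurable_indic; exact: measurableX.
  rewrite integral_indic ?setIT; last exact: measurableX.
  rewrite [X in (_ * X)%E]product_measure1E//.
  have I1 : lebesgue_measure I = 1%E.
    by rewrite lebesgue_measure_itv/= lte_fin ltr01 -EFinB subr0.
  by rewrite /= !I1 !mule1 lte_fin.
  exact: measurableT.
apply: ge0_le_integral => //.
- by move=> v _; rewrite -EFinM lee_fin mulr_ge0// ltW.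
- apply: measurable_funeM; apply/measurable_EFinP; apply: measurable_indic.
  exact: measurableX.
- by apply/measurable_EFinP; exact: measurable_riesz_gap.
move=> [x y] _; rewrite -EFinM lee_fin indicE.
have [|_] := boolP (_ \in _); last by rewrite mulr0 riesz_gap_ge0.
rewrite inE /I => -[/=]; rewrite !in_itv/= => /andP[x0 x1] /andP[y0 y1].
rewrite mulr1 /c /riesz_gap lerB ?riesz_le// ?mulr1//.
rewrite /riesz lef_pV2 ?posrE ?sqrtr_gt0//=; last first.
  by rewrite -addrA ltr_pwDl ?expr1n// addr_ge0 ?sqr_ge0.
rewrite ler_wsqrtr//; nra.
Qed.

Lemma ge0_integral_plane_scale (c : R) (F : RR * RR -> \bar R) : 0 < c ->
  measurable_fun setT F -> (forall p, (0 <= F p)%E) ->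
  (\int[P]_w F (c * w.1, c * w.2)%R = (c ^- 2)%:E * \int[P]_v F v)%E.
Proof.
move=> c0 mF F0.
have mFc : measurable_fun setT (fun w : RR * RR => F (c * w.1, c * w.2)%R).
  by apply: (measurableT_comp mF); apply: measurable_fun_pair; exact: measurable_funM.
rewrite (fubini_tonelli1 (m1 := lam) (m2 := lam) _ mFc)//.
rewrite (fubini_tonelli1 (m1 := lam) (m2 := lam) _ mF)// /fubini_F.
have mF1 := measurable_fun_fubini_tonelli_F (m2 := lam) F mF F0.
rewrite expr2 invfM EFinM -muleA.
have := ge0_integral_affine 0 c0 mF1 (fun x => integral_ge0 _ (fun y _ => F0 _)).
rewrite /fubini_F => <-.
have ic0 : 0 <= c^-1 by rewrite invr_ge0 ltW.
rewrite -ge0_integralZl//; last 2 first.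
- apply: (measurableT_comp (f := fubini_F lam F)) => //.
  by apply: measurable_funD => //; exact: measurable_funM.
- by move=> x _; exact: integral_ge0.
apply: eq_integral => x _.
have mFx : measurable_fun [set: RR] (fun y => F (c * x + 0, y)).
  exact: (measurableT_comp mF (pair1_measurable _)).
rewrite -(ge0_integral_affine 0 c0 mFx)//.
by apply: eq_integral => y _; rewrite !addr0.
Qed.

Lemma integral_plane_scale (c : R) (F : RR * RR -> \bar R) : 0 < c ->
  P.-integrable setT F ->
  (\int[P]_w F (c * w.1, c * w.2)%R = (c ^- 2)%:E * \int[P]_v F v)%E.
Proof.
move=> c0 jF; have mF := measurable_int _ jF.
rewrite [LHS]integralE [in RHS]integralE.
have := @ge0_integral_plane_scale c (F^\+)%E c0 (measurable_funepos mF) (funepos_ge0 F).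
have := @ge0_integral_plane_scale c (F^\-)%E c0 (measurable_funeneg mF) (funeneg_ge0 F).
have fp := integrable_pos_fin_num measurableT jF.
have fc : (c ^- 2)%:E \is a fin_num by [].
rewrite (muleBr fc (fin_num_adde_defr _ fp)).
move=> <- <-; congr (_ - _)%E; apply: eq_integral => x _;
by rewrite ?funeposE ?funenegE.
Qed.

End RieszGap.

Section Positivity.
Context {R : realType}.
Notation lam := (@lebesgue_measure R).
Notation RR := (measurableTypeR R).
Notation P := (@plane R).
Variables (E : set (RR * RR)) (M : R).
Hypothesis mE : measurable E.
Hypothesis bE : forall p, E p -> `|p.1| <= M /\ `|p.2| <= M.
Hypothesis E0 : (0 < P E)%E.

Let finE : (P E < +oo)%E := fin_bounded mE bE.

(** The coefficient of the sum of squares in autocorrelation_ge. *)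
Definition gain v := fine (P E) - 2 * fine (P (escape E v)).

Let mD : measurable_fun setT gain.
Proof.
apply: measurable_funB => //; apply: measurable_funM => //.
apply: measurableT_comp => //.
rewrite (_ : (fun v => _) = (fun v => \int[P]_p (\1_E p * (1 - \1_E (vadd p v)))%:E)%E).
  apply: (@measurable_integral_param _ _ _ _ R P
    (fun z => (\1_E z.1 * (1 - \1_E (vadd z.1 z.2)))%:E)).
  have mI : measurable_fun setT (\1_E : RR * RR -> R) by exact: measurable_indic.
  apply/measurable_EFinP; apply: measurable_funM; first exact: measurableT_comp.
  apply: measurable_funB => //; apply: (measurableT_comp mI).
  exact: measurable_vadd2.
apply/funext => v; rewrite -[in LHS](setIT (escape E v)) -integral_indic//; last first.
  exact: measurable_escape.
apply: eq_integral => p _; congr EFin; rewrite !indicE.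
have [pE|pE] := boolP (p \in escape E v).
  move: pE; rewrite inE => -[Ep nE]; rewrite mem_set//.
  by rewrite memNset// subr0 mulr1.
have [Ep|] := boolP (p \in E); last by rewrite mul0r.
have [Ev|nE] := boolP (vadd p v \in E); first by rewrite subrr mulr0.
exfalso; move/negP : pE; apply; rewrite inE; split; first by rewrite inE in Ep.
by rewrite notin_setE in nE.
Qed.

Let DK v : `|gain v| <= 2 * fine (P E).
Proof.
have e1 : fine (P (escape E v)) <= fine (P E).
  rewrite fine_le// ?ge0_fin_numE// ?(fin_escape mE finE)//.
  apply: le_measure; rewrite ?inE//; first exact: measurable_escape.
  by move=> p [].
have e2 : 0 <= fine (P (escape E v)) by rewrite fine_ge0.
by rewrite /gain ler_norml; lra.
Qed.

Lemma integrable_riesz_gap_gain a : 0 < a -> P.-integrable setT (fun v => (riesz_gap a v)%:E) ->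
  P.-integrable setT (fun v => (riesz_gap a v * gain v)%:E).
Proof. by move=> a0 ja; apply: (integrable_mul_bounded ja mD DK). Qed.

Lemma integrable_riesz_gap a : 0 < a -> P.-integrable setT (fun v => (riesz_gap a v)%:E).
Proof.
move=> a0; have mb : measurable_fun setT (fun v : RR * RR => (riesz_gap a v)%:E).
  by apply/measurable_EFinP; exact: measurable_riesz_gap.
have b0 (v : RR * RR) : (0 <= (riesz_gap a v)%:E)%E by rewrite lee_fin riesz_gap_ge0.
apply/integrableP; split => //.
under eq_integral do rewrite gee0_abs//.
have := ge0_integral_plane_scale a0 mb b0.
have a20 : 0 < a ^+ 2 by rewrite exprn_gt0.
move=> /(congr1 (fun z => (a ^+ 2)%:E * z)%E).
rewrite muleA -EFinM divff ?gt_eqF// mul1e => <-.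
rewrite (eq_integral (fun w : RR * RR => (a^-1)%:E * (riesz_gap 1 w)%:E)%E); last first.
  by move=> w _; rewrite (riesz_gap_scale w a0) -EFinM mulrA mulVf ?mul1r// gt_eqF.
have j1 := @integrable_riesz_gap1 R.
by rewrite (integralZl measurableT j1) -(fineK (integrable_fin_num measurableT j1)) -!EFinM ltry.
Qed.

(** After the substitution v = a * w the integral is, up to a positive factor,
    the integral of riesz_gap 1 w * gain (a * w), and gain (a * w) tends to the
    measure of E, which is positive, as a tends to 0. *)
Lemma exists_scale : exists2 a : R, 0 < a &
  (0 < \int[P]_v (riesz_gap a v * gain v)%:E)%E.
Proof.
pose a (n : nat) : R := n.+1%:R^-1.
have a0 n : 0 < a n by rewrite invr_gt0.
have acvg : a @ \oo --> (0 : R) by exact: cvg_harmonic.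
pose F n (w : RR * RR) : \bar R := (riesz_gap 1 w * gain (a n * w.1, a n * w.2))%:E.
pose L (w : RR * RR) : \bar R := (riesz_gap 1 w * fine (P E))%:E.
have Fcvg : (\int[P]_w F n w @[n --> \oo] --> \int[P]_w L w)%E.
  apply: (@dominated_cvg _ _ _ P setT measurableT F L
    (fun w => (2 * fine (P E))%:E * (riesz_gap 1 w)%:E)%E).
  - move=> n; apply/measurable_EFinP; apply: measurable_funM.
      exact: measurable_riesz_gap.
    apply: (measurableT_comp mD).
    by apply: measurable_fun_pair; exact: measurable_funM.
  - move=> w _; rewrite /F /L.
    apply: cvg_EFin; first by apply: nearW.
    apply: cvgM; first exact: cvg_cst.
    rewrite -[X in _ --> X]subr0; apply: cvgB; first exact: cvg_cst.
    rewrite -[X in _ --> X](mulr0 2); apply: cvgM; first exact: cvg_cst.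
    have c1 : (fun n => a n * w.1) @ \oo --> (0 : R).
      by rewrite -[X in _ --> X](mul0r w.1); apply: cvgM => //; exact: cvg_cst.
    have c2 : (fun n => a n * w.2) @ \oo --> (0 : R).
      by rewrite -[X in _ --> X](mul0r w.2); apply: cvgM => //; exact: cvg_cst.
    have := escape_cvg mE bE c1 c2.
    by move/fine_cvgP => [_].
  - by move=> w _; rewrite -EFinM.
  - by apply: integrableZl => //; exact: integrable_riesz_gap1.
  - move=> n w _; rewrite /F -EFinM /= lee_fin normrM mulrC.
    by rewrite ler_pM// ger0_norm// riesz_gap_ge0.
have L0 : (0 < \int[P]_w L w)%E.
  rewrite /L; under eq_integral do rewrite EFinM.
  rewrite integralZr//; last exact: integrable_riesz_gap1.
  by rewrite mule_gt0 ?integral_riesz_gap1_gt0// lte_fin fine_gt0// E0 finE.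
have jL : P.-integrable setT L.
  apply: (@integrable_mul_bounded _ _ _ P (riesz_gap 1) (fun=> fine (P E)) `|fine (P E)|) => //.
  exact: integrable_riesz_gap1.
have [l Ll] : exists l, (\int[P]_w L w)%E = l%:E.
  by exists (fine (\int[P]_w L w)%E); rewrite fineK// integrable_fin_num.
rewrite Ll in Fcvg L0; move: Fcvg => /fine_cvgP[Ffin] /cvgr_gt/(_ 0).
rewrite lte_fin in L0; move=> /(_ L0) Fgt.
near \oo => n.
have Fn : 0 < fine (\int[P]_w F n w)%E by near: n.
exists (a n) => //.
have ja := integrable_riesz_gap_gain (a0 n) (integrable_riesz_gap (a0 n)).
have [r Ir] : exists r, (\int[P]_v (riesz_gap (a n) v * gain v)%:E)%E = r%:E.
  exists (fine (\int[P]_v (riesz_gap (a n) v * gain v)%:E)%E).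
  by rewrite fineK// integrable_fin_num.
have E1 : (\int[P]_w F n w)%E = (a n ^- 2 * (a n * r))%:E.
  rewrite EFinM EFinM -Ir -(integralZl measurableT ja).
  rewrite -(integral_plane_scale (a0 n) (integrableZl measurableT (a n) ja)).
  by apply: eq_integral => w _; rewrite /F (riesz_gap_scale w (a0 n)) -EFinM mulrA.
move: Fn; rewrite E1 Ir /= lte_fin.
by rewrite pmulr_rgt0 ?invr_gt0 ?exprn_gt0// pmulr_rgt0.
Unshelve. all: end_near.
Qed.

End Positivity.

(** * The inequality for real weights *)

Section Core.
Context {R : realType}.
Notation lam := (@lebesgue_measure R).
Notation RR := (measurableTypeR R).
Notation P := (@plane R).

(** The difference of the energies at the scales a and 2 * a, for the a of
    exists_scale, is estimated from below by autocorrelation_ge and from above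
    by energy_bound.  The constant depends on E alone. *)
Lemma tiles_energy (E : set (RR * RR)) (M : R) :
  measurable E -> (forall p, E p -> `|p.1| <= M /\ `|p.2| <= M) -> (0 < P E)%E ->
  exists2 c : R, 0 < c &
  forall (G : seq (R * R)) (x : R * R -> R) (rho eps : R) (p0 : R * R),
    uniq G ->
    (forall g h p, g \in G -> h \in G ->
       E (vadd p (- g)) -> E (vadd p (- h)) -> g = h) ->
    0 <= rho -> 0 <= eps ->
    (forall p, tiles E G x p != 0 ->
       (p.1 - p0.1) ^+ 2 + (p.2 - p0.2) ^+ 2 <= rho ^+ 2) ->
    (forall m, {ae lam, forall b,
      (`|\int[lam]_t (tiles E G x (t, b + m * t)%R)%:E| <=
       (eps / Num.sqrt (1 + m ^+ 2))%:E)%E}) ->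
    c * \sum_(g <- G) x g ^+ 2 <= rho * eps ^+ 2.
Proof.
move=> mE bE E0.
have finE := fin_bounded mE bE.
have [a a0 I0] := exists_scale mE bE E0.
have jb : P.-integrable setT (fun v => (riesz_gap a v)%:E) by exact: integrable_riesz_gap.
have jbD : P.-integrable setT (fun v => (riesz_gap a v * gain E v)%:E).
  exact: (integrable_riesz_gap_gain mE bE a0 jb).
have [i iE] : exists i, (\int[P]_v (riesz_gap a v * gain E v)%:E)%E = i%:E.
  by exists (fine (\int[P]_v (riesz_gap a v * gain E v)%:E)%E); rewrite fineK// integrable_fin_num.
have i0 : 0 < i by rewrite -lte_fin -iE.
have pi0 := pi_gt0 R.
exists (i / (4 * pi)); first by rewrite divr_gt0// mulr_gt0.
move=> G x rho eps p0 uG disj rho0 eps0 supp thin.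
set f := tiles E G x.
have jf : P.-integrable setT (EFin \o f) by exact: integrable_tiles.
set S := \sum_(g <- G) x g ^+ 2.
have bK v : `|riesz_gap a v| <= a^-1 by rewrite ger0_norm ?riesz_gap_ge0// riesz_gap_le.
have [jA EA] := integral_autocorrelation jf (measurable_riesz_gap a) bK.
have low : ((S * i)%:E <= \int[sfprod P P]_z (f z.1 * f z.2 * riesz_gap a (vdiff z))%:E)%E.
  rewrite EA EFinM -iE -(integralZl measurableT jbD).
  apply: le_integral => //; first exact: integrableZl.
  move=> v _.
  have jff : P.-integrable setT (fun p => (f p * f (vadd p v))%:E).
    exact: integrable_tiles_product.
  rewrite (eq_integral (fun p => (riesz_gap a v)%:E * (f p * f (vadd p v))%:E)%E); last first.
    by move=> p _; rewrite -EFinM mulrC.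
  rewrite (integralZl measurableT jff) EFinM muleCA.
  apply: lee_wpmul2l; first by rewrite lee_fin riesz_gap_ge0.
  rewrite -EFinM.
  exact: autocorrelation_ge.
have a20 : 0 < 2 * a by rewrite mulr_gt0.
have up1 := energy_bound a0 rho0 eps0 jf supp thin.
have up2 := energy_bound a20 rho0 eps0 jf supp thin.
have jr b : 0 < b -> (sfprod P P).-integrable setT
    (fun z => (f z.1 * f z.2 * riesz b (vdiff z))%:E).
  move=> b0; apply: (@integrable_mul_bounded _ _ _ _ _ _ b^-1 (integrable_square jf)).
    by apply: (measurableT_comp (measurable_riesz b)); exact: measurable_vdiff.
  by move=> z; rewrite ger0_norm ?riesz_ge0// riesz_le.
have : ((S * i)%:E <= (4 * pi * rho * eps ^+ 2)%:E)%E.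
  apply: (le_trans low).
  rewrite (_ : (\int[_]_z _)%E = (\int[sfprod P P]_z (f z.1 * f z.2 * riesz a (vdiff z))%:E
     - \int[sfprod P P]_z (f z.1 * f z.2 * riesz (2 * a) (vdiff z))%:E)%E); last first.
    rewrite -integralB//; [|exact: jr|exact: jr].
    by apply: eq_integral => z _; rewrite -EFinB -mulrBr.
  have -> : 4 * pi * rho * eps ^+ 2 = 2 * pi * rho * eps ^+ 2 + 2 * pi * rho * eps ^+ 2.
    by ring.
  rewrite EFinD leeD//; first exact: le_trans (lee_abs _) up1.
  by apply: le_trans (lee_abs _) _; rewrite abseN.
rewrite lee_fin => h.
rewrite mulrAC ler_pdivrMr ?mulr_gt0// mulrC.
by rewrite (le_trans h)// le_eqVlt; apply/orP; left; apply/eqP; ring.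
Qed.

End Core.

(** * Lebesgue measurable functions on a line *)

Section Completed.
Context {R : realType}.
Notation lam := (@lebesgue_measure R).
Notation RR := (measurableTypeR R).
Notation clam := (@completed_lebesgue_measure R).
Notation CR := (caratheodory_type ((wlength (@idfun R))^*)%mu).

Lemma measurable_caratheodory_id :
  measurable_fun [set: CR] (idfun : CR -> RR).
Proof.
move=> _ A mA; rewrite setTI.
by apply: sub_caratheodory.
Qed.

(** Lebesgue measure is the image of its completion under the identity, which
    is measurable from the larger sigma-algebra to the Borel one. *)
Lemma ge0_integral_completed (g : RR -> \bar R) : measurable_fun setT g ->
  (forall t, 0 <= g t)%E -> (\int[clam]_t g t = \int[lam]_t g t)%E.
Proof.
move=> mg g0.
have := @ge0_integral_pushforward _ _ CR RR R idfun measurable_caratheodory_id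
  clam setT g measurableT mg (fun x _ => g0 x).
rewrite preimage_setT => <-; apply: eq_measure_integral.
  exact: measurable_caratheodory_id.
by move=> ? A mA _.
Qed.

Lemma integral_completed (g : RR -> \bar R) : measurable_fun setT g ->
  (\int[clam]_t g t = \int[lam]_t g t)%E.
Proof.
move=> mg; rewrite [LHS]integralE [RHS]integralE.
have := ge0_integral_completed (measurable_funepos mg) (funepos_ge0 g).
have := ge0_integral_completed (measurable_funeneg mg) (funeneg_ge0 g).
by move=> -> ->.
Qed.

Lemma ae_eq_completed (N : set RR) (g h : RR -> R) : measurable N -> lam N = 0%E ->
  measurable_fun setT g -> (forall t, ~ N t -> h t = g t) ->
  measurable_fun [set: CR] (h : CR -> R) /\
  (\int[clam]_t (h t)%:E = \int[lam]_t (g t)%:E)%E.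
Proof.
move=> mN N0 mg hg.
have mgC : measurable_fun [set: CR] (fun t : CR => (g t)%:E).
  apply/measurable_EFinP.
  exact: (measurableT_comp mg measurable_caratheodory_id).
have E : ae_eq clam setT (fun t : CR => (g t)%:E) (fun t : CR => (h t)%:E).
  exists N; split => //; first exact: sub_caratheodory.
  by move=> t /=; apply: contra_notP => Nt _; rewrite hg.
have mhC : measurable_fun [set: CR] (fun t : CR => (h t)%:E).
  exact: (ae_measurable_fun (@completed_lebesgue_measure_is_complete R) E mgC).
split; first exact/measurable_EFinP.
rewrite -integral_completed; last exact/measurable_EFinP.
by apply/esym/ae_eq_integral.
Qed.
End Completed.

Section Lines.
Context {R : realType}.
Notation lam := (@lebesgue_measure R).
Notation RR := (measurableTypeR R).
Notation clam := (@completed_lebesgue_measure R).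
Notation CR := (caratheodory_type ((wlength (@idfun R))^*)%mu).
Notation P := (@plane R).

(** integral_shear with weight 1: the integral of the lengths of the sections is
    the area of A. *)
Lemma ae_null_section (A : set (RR * RR)) (m : R) : measurable A -> P A = 0%E ->
  {ae lam, forall b, lam [set x | A (x, b + m * x)] = 0%E}.
Proof.
move=> mA A0.
have jA : P.-integrable setT (EFin \o (\1_A : RR * RR -> R)).
  have finA : (P A < +oo)%E by rewrite A0 ltry.
  exact: integrable_indic_fin.
have mc : measurable_fun [set: RR] (cst 1 : RR -> R) by [].
have c1 (b : RR) : `|(cst 1 : RR -> R) b| <= 1 by rewrite /= normr1.
have := integral_shear m jA mc c1.
under eq_integral do rewrite /= mulr1.
rewrite integral_indic// setIT => I0'.
have I0 := etrans (esym I0') A0.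
have mAs : measurable ((fun z : RR * RR => (z.1, z.2 + m * z.1) : RR * RR) @^-1` A).
  by rewrite -[X in measurable X]setTI; apply: measurable_shear.
have secE b : (\int[lam]_x (\1_A (x, (b + m * x)%R) * cst 1 b)%:E)%E =
    lam [set x | A (x, b + m * x)].
  under eq_integral do rewrite /= mulr1.
  have mb : measurable ([set x | A (x, b + m * x)] : set RR).
    have := pair2_measurable (T1 := RR) b measurableT mAs; rewrite setTI; exact.
  rewrite -[in RHS](setIT [set x | A (x, b + m * x)]) -integral_indic//.
have mF : measurable_fun [set: RR] (fun b => lam [set x | A (x, b + m * x)]).
  rewrite (_ : (fun b => _) = (fun b : RR => \int[lam]_x (\1_A (x, (b + m * x)%R) * 1)%:E)%E).
    apply: (@measurable_integral_param _ _ RR RR R lam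
      (fun z : RR * RR => (\1_A (z.1, z.2 + m * z.1) * 1)%:E)).
    apply/measurable_EFinP; apply: measurable_funM => //.
    apply: (measurableT_comp (f := (\1_A : RR * RR -> R))).
      exact: measurable_indic.
    exact: measurable_shear.
  by apply/funext => b; rewrite -secE.
have : (\int[lam]_b `|lam [set x | A (x, (b + m * x)%R)]| = 0)%E.
  rewrite -[RHS]I0; apply: eq_integral => b _; rewrite gee0_abs//.
move/(ae_eq_integral_abs lam measurableT mF).
by apply: filterS => b /(_ I).
Qed.

(** The passage from the parametrization of the line by x to the one by
    arclength, t = s * x. *)
Lemma integral_on_line (A : set (RR * RR)) (h g : R * R -> R) (m b : R) :
  measurable A -> lam [set x | A (x, b + m * x)] = 0%E ->
  measurable_fun [set: RR * RR] g -> (forall p, ~ A p -> h p = g p) ->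
  lam.-integrable setT (fun x => (g (x, b + m * x))%:E) ->
  let s := Num.sqrt (1 + m ^+ 2) in
  let F t := h ((0, b) + t *: (s^-1, s^-1 * m)) in
  measurable_fun [set: CR] (F : CR -> R) /\
  (\int[clam]_t (F t)%:E = s%:E * \int[lam]_x (g (x, b + m * x)%R)%:E)%E.
Proof.
move=> mA A0 mg hg jg s F.
have s0 : 0 < s by rewrite sqrtr_gt0 one_plus_sqr_gt0.
have is0 : 0 < s^-1 by rewrite invr_gt0.
have mAs : measurable ((fun z : RR * RR => (z.1, z.2 + m * z.1) : RR * RR) @^-1` A).
  by rewrite -[X in measurable X]setTI; apply: measurable_shear.
have mb : measurable ([set x | A (x, b + m * x)] : set RR).
  have := pair2_measurable (T1 := RR) b measurableT mAs; rewrite setTI; exact.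
pose N : set RR := (fun t => s^-1 * t + 0) @^-1` [set x | A (x, b + m * x)].
have mN : measurable N.
  by rewrite /N -[X in measurable X]setTI; apply: measurable_affine.
have N0 : lam N = 0%E by rewrite /N lebesgue_measure_affine// A0 mule0.
have mgs : measurable_fun [set: RR] (fun x => g (x, b + m * x)).
  by apply/measurable_EFinP; exact: measurable_int jg.
have FE t : (0, b) + t *: (s^-1, s^-1 * m) =
    (s^-1 * t + 0, b + m * (s^-1 * t + 0)) :> R * R.
  by apply: injective_projections; rewrite /= /GRing.scale/=; ring.
have hF t : ~ N t -> F t = g (s^-1 * t + 0, b + m * (s^-1 * t + 0)).
  by move=> Nt; rewrite /F FE hg.
have mgF := measurableT_comp mgs (measurable_affine s^-1 0).
have [mF ->] := ae_eq_completed mN N0 mgF hF.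
split => //.
by rewrite (integral_affine 0 is0 jg) invrK.
Qed.

Lemma Re_coloring (Q : set (R * R)) (G : {fset R * R}) (z : R * R -> R[i]) p :
  complex.Re (coloring Q G z p) = \sum_(g <- G) complex.Re (z g) * \1_Q (p - g).
Proof.
rewrite /coloring; elim/big_rec2 : _ => // g x y _ <-.
by case: (z g) y => a c [x1 x2] /=; rewrite mulr0 subr0.
Qed.

Lemma Im_coloring (Q : set (R * R)) (G : {fset R * R}) (z : R * R -> R[i]) p :
  complex.Im (coloring Q G z p) = \sum_(g <- G) complex.Im (z g) * \1_Q (p - g).
Proof.
rewrite /coloring; elim/big_rec2 : _ => // g x y _ <-.
by case: (z g) y => a c [x1 x2] /=; rewrite mulr0 add0r.
Qed.

End Lines.

(** * Lattices, fundamental domains and diameters *)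

Section Geometry.
Context {R : realType}.
Notation lam := (@lebesgue_measure R).
Notation RR := (measurableTypeR R).
Notation P := (@plane R).
Implicit Types (x y p : R * R) (T Q : set (R * R)).

Lemma euclid_ge0 x : 0 <= euclid x. Proof. exact: sqrtr_ge0. Qed.

Lemma sqr_euclid x : euclid x ^+ 2 = x.1 ^+ 2 + x.2 ^+ 2.
Proof. by rewrite sqr_sqrtr// addr_ge0 ?sqr_ge0. Qed.

Lemma euclidD x y : euclid (x + y) <= euclid x + euclid y.
Proof.
have h : 0 <= euclid x + euclid y by rewrite addr_ge0 ?euclid_ge0.
have cs : x.1 * y.1 + x.2 * y.2 <= euclid x * euclid y.
  have exy : 0 <= euclid x * euclid y by rewrite mulr_ge0 ?euclid_ge0.
  rewrite (le_trans (ler_norm _))// -ler_sqr ?nnegrE// real_normK ?num_real//.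
  rewrite exprMn !sqr_euclid -subr_ge0 [leRHS](_ : _ = (x.1 * y.2 - x.2 * y.1) ^+ 2) ?sqr_ge0//.
  by ring.
rewrite -ler_sqr ?nnegrE ?euclid_ge0// sqrrD !sqr_euclid/=.
by move: cs; rewrite -[_ *+ 2]mulr_natr; lra.
Qed.

Lemma norm_le_euclid x : `|x| <= euclid x.
Proof.
rewrite prod_normE ge_max; apply/andP; split.
  by rewrite -sqrtr_sqr ler_wsqrtr// lerDl sqr_ge0.
by rewrite -sqrtr_sqr ler_wsqrtr// lerDr sqr_ge0.
Qed.

Lemma euclid_le_norm x : euclid x <= 2 * `|x|.
Proof.
have n0 : 0 <= 2 * `|x| by rewrite mulr_ge0.
rewrite -ler_sqr ?nnegrE ?euclid_ge0// sqr_euclid.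
have h1 : x.1 ^+ 2 <= `|x| ^+ 2.
  by rewrite -[x.1 ^+ 2]real_normK ?num_real// ler_sqr ?nnegrE// prod_normE le_max lexx.
have h2 : x.2 ^+ 2 <= `|x| ^+ 2.
  by rewrite -[x.2 ^+ 2]real_normK ?num_real// ler_sqr ?nnegrE// prod_normE le_max lexx orbT.
rewrite exprMn; have := sqr_ge0 `|x|; lra.
Qed.

Lemma lattice_min_dist T : is_lattice T ->
  exists2 d : R, 0 < d & forall t, T t -> t != 0 -> d <= euclid t.
Proof.
move=> [T0 _ /(_ _ T0)[_ [V V0 VT]] _].
move: V0; rewrite -nbhs_ballE => -[d /= d0 dV].
exists d => // t Tt tn0; rewrite leNgt; apply/negP => td.
have : (V `&` T) t.
  split => //; apply: dV; rewrite prod_norm_ball /ball_/= sub0r normrN.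
  exact: le_lt_trans (norm_le_euclid t) td.
by rewrite VT /= => t0; rewrite t0 eqxx in tn0.
Qed.

Lemma bounded_norm_le Q : bounded_set Q ->
  exists2 M : R, 0 <= M & forall p, Q p -> `|p| <= M.
Proof.
move=> [M [_ QM]]; exists (Num.max (M + 1) 0); first by rewrite le_max lexx orbT.
move=> p Qp; apply: QM => //=.
by rewrite lt_max ltrDl ltr01.
Qed.

(** The sum of all distances serves as an upper bound, which the supremum
    requires. *)
Lemma diam_ge (G : {fset R * R}) g h : g \in G -> h \in G ->
  euclid (g - h) <= diam [set` G].
Proof.
move=> gG hG; apply: ub_le_sup; last by exists (g, h).
exists (\sum_(i <- G) \sum_(j <- G) euclid (i - j)) => _ [[a b] [aG bG] <-] /=.
rewrite (big_fsetD1 a)//= (big_fsetD1 b)//= -addrA lerDl.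
by rewrite addr_ge0// sumr_ge0// => i _; rewrite ?sumr_ge0// => *; exact: euclid_ge0.
Qed.

Lemma diam_le0 (G : {fset R * R}) : (forall g h, g \in G -> h \in G -> g = h) ->
  diam [set` G] <= 0.
Proof.
move=> one; rewrite /diam.
have [->|/set0P ne] := eqVneq [set euclid (x.1 - x.2) | x in [set` G] `*` [set` G]] set0.
  by rewrite sup0.
apply: ge_sup => // _ [[a b] [/= aG bG] <-].
by rewrite (one a b)// subrr /euclid/= expr0n addr0 sqrtr0.
Qed.

(** If p - g and p - h both lie in Q they are the representative of the class
    of p. *)
Lemma fundamental_domain_disjoint T Q : is_lattice T ->
  is_fundamental_domain T Q -> forall g h p, T g -> T h ->
  Q (p - g) -> Q (p - h) -> g = h.
Proof.
move=> [T0 TB _ _] fd g h p Tg Th Qg Qh.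
have TN t : T t -> T (- t) by move=> Tt; rewrite -sub0r; exact: TB.
have [q [_ uq]] := fd p.
have e1 : q = p - g by apply: uq; split => //; rewrite addrC addKr; exact: TN.
have e2 : q = p - h by apply: uq; split => //; rewrite addrC addKr; exact: TN.
by apply: oppr_inj; apply: (addrI p); rewrite -e1 -e2.
Qed.

Lemma plane_setT_neq0 : P setT <> 0%E.
Proof.
move=> PT; pose I : set RR := `[0, 1]%classic.
have mI : measurable I by exact: measurable_itv.
have I1 : lam I = 1%E.
  by rewrite lebesgue_measure_itv/= lte_fin ltr01 -EFinB subr0.
have : (P (I `*` I) <= P setT)%E.
  by apply: le_measure; rewrite ?inE//; exact: measurableX.
by rewrite PT /plane/sfprod product_measure1E//= I1 mule1 lee_fin ler10.
Qed.

Lemma plane_translate (Z : set (RR * RR)) v : measurable Z ->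
  P (vadd ^~ v @^-1` Z) = P Z.
Proof.
move=> mZ; have mZv := measurable_translate mZ v.
have mI : measurable_fun setT (fun p : RR * RR => (\1_Z p : R)%:E).
  by apply/measurable_EFinP; exact: measurable_indic.
rewrite -[in RHS](setIT Z) -integral_indic//.
rewrite -(ge0_integral_vadd v mI); last by move=> p; rewrite lee_fin.
by rewrite -[in LHS](setIT (vadd ^~ v @^-1` Z)) -integral_indic.
Qed.

Lemma negligible_translate (Z : set (RR * RR)) v : measurable Z ->
  P Z = 0%E -> P.-negligible (vadd ^~ v @^-1` Z).
Proof.
move=> mZ Z0; apply/negligibleP; first exact: measurable_translate.
by rewrite -Z0; exact: plane_translate.
Qed.

(** The lattice is countable, by its basis, and the translates of Z cover the
    plane: if Z were null, the plane would be null. *)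
Lemma fundamental_domain_not_null T Q (Z : set (RR * RR)) :
  has_area T 1 -> is_fundamental_domain T Q ->
  measurable Z -> Q `<=` Z -> P Z <> 0%E.
Proof.
move=> [u [v [[_ _ basis] _]]] fd mZ QZ Z0; apply: plane_setT_neq0.
pose F n : set (RR * RR) :=
  if (choice.unpickle n : option (int * int)) is Some m
  then vadd ^~ (u *~ m.1 + v *~ m.2) @^-1` Z else set0.
have nF n : P.-negligible (F n).
  rewrite /F; case: choice.unpickle => [m|]; last exact: negligible_set0.
  exact: negligible_translate.
have := negligible_bigcup nF => /negligibleS; move=> /(_ setT).
rewrite -negligibleP; last exact: measurableT.
apply => p _.
have [q [[Qq Tqp] _]] := fd p.
have [m [qm _]] := basis _ Tqp.
have Fm : F (choice.pickle m) = vadd ^~ (u *~ m.1 + v *~ m.2) @^-1` Z.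
  by rewrite /F choice.pickleK.
exists (choice.pickle m); first by [].
rewrite Fm.
apply: QZ; rewrite (_ : vadd _ _ = q)// -qm /vadd/=.
by rewrite ![p.1 + _]addrC ![p.2 + _]addrC !subrK -surjective_pairing.
Qed.

End Geometry.

(** * From the colouring of the plane to lines *)

Section Assembly.
Context {R : realType}.
Notation lam := (@lebesgue_measure R).
Notation RR := (measurableTypeR R).
Notation P := (@plane R).

Lemma null_translates (N : set (RR * RR)) (s : seq (R * R)) :
  measurable N -> P N = 0%E ->
  exists A : set (RR * RR), [/\ measurable A, P A = 0%E &
    forall g p, g \in s -> N (vadd p (- g)) -> A p].
Proof.
move=> mN N0; elim: s => [|g s [A [mA A0 As]]]; first by exists set0; rewrite measure0.
have mNg := measurable_translate mN (- g).
have nNg := negligible_translate (- g) mN N0.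
have nA : P.-negligible A by apply/negligibleP.
have mU : measurable (A `|` vadd ^~ (- g) @^-1` N) by exact: measurableU.
exists (A `|` vadd ^~ (- g) @^-1` N); split => //.
  by apply: (measure_negligible mU); exact: negligibleU.
move=> h p; rewrite in_cons => /predU1P[->|hs Nh]; first by right.
by left; exact: As Nh.
Qed.

Section good_lines_of_slope.
Variables (Q B N : set (RR * RR)) (G : {fset R * R}) (z : R * R -> R[i]) (m : R).
Hypotheses (mB : measurable B) (finB : (P B < +oo)%E).
Hypotheses (mN : measurable N) (N0 : P N = 0%E).
Hypotheses (BQ : B `<=` Q) (QBN : Q `<=` B `|` N).

Let s := Num.sqrt (1 + m ^+ 2).

(** The line with intercept b is good if it misses, up to a null set, the
    translates of the null set by which Q and B differ.  Then the arclength
    integral of the colouring is s times the integral in x of the colouring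
    built from B. *)
Lemma good_lines : {ae lam, forall b,
  [/\ measurable_on_line (coloring Q G z) (0, b) (s^-1, s^-1 * m),
      (\int[lam]_x (tiles B G (fun g => complex.Re (z g)) (x, b + m * x)%R)%:E =
        (s^-1 * complex.Re (line_integral (coloring Q G z) (0, b) (s^-1, (s^-1 * m)%R)))%:E)%E &
      (\int[lam]_x (tiles B G (fun g => complex.Im (z g)) (x, b + m * x)%R)%:E =
        (s^-1 * complex.Im (line_integral (coloring Q G z) (0, b) (s^-1, (s^-1 * m)%R)))%:E)%E]}.
Proof.
have s0 : 0 < s by rewrite sqrtr_gt0 one_plus_sqr_gt0.
have [A [mA A0 AN]] := null_translates G mN N0.
have jt x : P.-integrable setT (EFin \o tiles B G x) by exact: integrable_tiles.
have mt x : measurable_fun setT (tiles B G x).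
  by apply/measurable_EFinP; exact: measurable_int (jt x).
have off x p : ~ A p -> \sum_(g <- G) x g * \1_Q (p - g) = tiles B G x p.
  move=> nA; apply: eq_big_seq => g gG; congr (_ * _).
  rewrite !indicE (_ : (p - g \in Q) = (vadd p (- g) \in B))//.
  apply/idP/idP; rewrite !inE; last exact: BQ.
  by move=> /QBN[//|Np]; exfalso; apply: nA; apply: (AN g).
move: (ae_integrable_section m (jt (fun g => complex.Re (z g))))
      (ae_integrable_section m (jt (fun g => complex.Im (z g))))
      (ae_null_section m mA A0).
apply: filterS3; first exact: (ae_filter_ringOfSetsType lam).
move=> b jre jim Ab.
have hre p : ~ A p -> complex.Re (coloring Q G z p) = tiles B G (fun g => complex.Re (z g)) p.
  by move=> nA; rewrite Re_coloring off.
have him p : ~ A p -> complex.Im (coloring Q G z p) = tiles B G (fun g => complex.Im (z g)) p.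
  by move=> nA; rewrite Im_coloring off.
have [mre ire] := integral_on_line mA Ab (mt _) hre jre.
have [mim iim] := integral_on_line mA Ab (mt _) him jim.
have fre := integrable_fin_num measurableT jre.
have fim := integrable_fin_num measurableT jim.
split; first by split; [exact: mre|exact: mim].
- rewrite /line_integral/= /Rintegral /on_line ire -(fineK fre) -EFinM/=.
  by rewrite mulrA mulVf ?mul1r// gt_eqF.
- rewrite /line_integral/= /Rintegral /on_line iim -(fineK fim) -EFinM/=.
  by rewrite mulrA mulVf ?mul1r// gt_eqF.
Qed.

End good_lines_of_slope.

Lemma ae_nonempty (S : set R) : {ae lam, forall b, S b} -> exists b, S b.
Proof.
move=> [N [mN N0 SN]]; apply: contrapT => nS.
have NT : N = setT.
  by apply/seteqP; split => // b _; apply: SN => /= Sb; apply: nS; exists b.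
have : (lam `[0%R, 1%R]%classic <= lam N)%E.
  by apply: le_measure; rewrite ?inE// NT.
by rewrite N0 lebesgue_measure_itv/= lte_fin ltr01 -EFinB subr0 lee_fin ler10.
Qed.

Lemma euclid_slope (m : R) :
  let s := Num.sqrt (1 + m ^+ 2) in euclid (s^-1, s^-1 * m) = 1.
Proof.
move=> s; have m0 := one_plus_sqr_gt0 m.
have s0 : 0 < s by rewrite sqrtr_gt0.
have s2 : s ^+ 2 = 1 + m ^+ 2 by rewrite sqr_sqrtr// ltW.
rewrite /euclid/= (_ : _ + _ = (1 + m ^+ 2) / s ^+ 2); last first.
  by field; rewrite gt_eqF.
by rewrite s2 divff ?sqrtr1// gt_eqF.
Qed.

Lemma normc_Re_Im (w : R[i]) :
  [/\ `|complex.Re w| <= normc w, `|complex.Im w| <= normc w &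
      normc w ^+ 2 = complex.Re w ^+ 2 + complex.Im w ^+ 2].
Proof.
case: w => x y /=; split.
- by rewrite -sqrtr_sqr ler_wsqrtr// lerDl sqr_ge0.
- by rewrite -sqrtr_sqr ler_wsqrtr// lerDr sqr_ge0.
- by rewrite sqr_sqrtr// addr_ge0 ?sqr_ge0.
Qed.

End Assembly.


(** * The theorem *)

Lemma powR_inv_sqrt (R : realType) (D : R) : 0 < D ->
  (D `^ (- 2^-1)) ^+ 2 = D^-1.
Proof.
move=> D0; rewrite powRN powR12_sqrt ?ltW// exprVn sqr_sqrtr//; exact: ltW.
Qed.

Theorem theorem1 (R : realType) (T Q : set (R * R)) :
  is_lattice T ->
  has_area T 1 ->
  bounded_set Q ->
  lebesgue_measurable2 Q ->
  is_fundamental_domain T Q ->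
  exists2 C : R, 0 < C &
    forall (G : {fset (R * R)}) (z : R * R -> R[i]),
      [set` G] `<=` T ->
      exists p u : R * R,
        [/\ euclid u = 1,
            measurable_on_line (coloring Q G z) p u &
            C * diam [set` G] `^ (- 2^-1) *
              Num.sqrt (\sum_(g <- G) normc (z g) ^+ 2)
            <= normc (line_integral (coloring Q G z) p u)].
Proof.
move=> lT area /bounded_norm_le[M M0 QM] [B mB [N' [N [mN N0 N'N]] QE]] fd.
have BQ : B `<=` Q by move=> p Bp; rewrite -QE; left.
have QBN : Q `<=` B `|` N.
  by move=> p; rewrite -QE => -[Bp|/N'N Np]; [left|right].
have [d d0 dT] := lattice_min_dist lT.
have bB p : B p -> `|p.1| <= M /\ `|p.2| <= M.
  move=> /BQ/QM pM; split; apply: le_trans pM;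
  by rewrite prod_normE le_max lexx ?orbT.
have finB := fin_bounded mB bB.
have mBN : measurable (B `|` N) by exact: measurableU.
have B0 : (0 < plane B)%E.
  rewrite lt0e measure_ge0 andbT; apply/eqP => PB.
  apply: (fundamental_domain_not_null area fd mBN QBN).
  apply: (measure_negligible mBN); apply: negligibleU.
    by apply/negligibleP.
  by apply/negligibleP.
have [c c0 core] := tiles_energy mB bB B0.
(* The support of the colouring lies in a disc of radius diam G + 2 * M, which
   is at most kap * diam G as soon as G has two points; C is chosen so that
   two applications of core give half of what they should. *)
pose kap := 1 + 2 * M / d.
have kap0 : 0 < kap by rewrite ltr_pwDl// divr_ge0 ?mulr_ge0// ltW.
pose C := Num.sqrt (c / (4 * kap)).
have C2 : C ^+ 2 = c / (4 * kap).
  by rewrite sqr_sqrtr// divr_ge0 ?mulr_ge0 ?ltW.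
have C0 : 0 < C by rewrite sqrtr_gt0 divr_gt0// mulr_gt0.
exists C => // G z GT.
apply: contrapT => noline.
set D := diam [set` G].
set S := \sum_(g <- G) normc (z g) ^+ 2.
pose eps := C * D `^ (- 2^-1) * Num.sqrt S.
have eps_ge0 : 0 <= eps.
  by rewrite !mulr_ge0 ?powR_ge0 ?sqrtr_ge0// ltW.
have line_lt (m b : R) (s := Num.sqrt (1 + m ^+ 2)) :
    measurable_on_line (coloring Q G z) (0, b) (s^-1, s^-1 * m) ->
    normc (line_integral (coloring Q G z) (0, b) (s^-1, s^-1 * m)) < eps.
  move=> mline; rewrite ltNge; apply/negP => le; apply: noline.
  exists (0, b), (s^-1, s^-1 * m); split => //; exact: euclid_slope.
have gl m := good_lines G z m mB finB mN N0 BQ QBN.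
(* Good lines exist, so the strict bound line_lt already excludes eps = 0; this
   disposes of the sets G with at most one point, for which the power of the
   diameter is 0, and of z = 0. *)
have eps0 : 0 < eps.
  have [b [mline _ _]] := ae_nonempty (gl 0).
  by apply: le_lt_trans (line_lt 0 b mline); case: (line_integral _ _ _) => ? ?; exact: sqrtr_ge0.
have thin (x : R * R -> R) (r : R[i] -> R) :
    (forall w, `|r w| <= normc w) ->
    (forall m, {ae (@lebesgue_measure R), forall b,
       measurable_on_line (coloring Q G z) (0, b)
         ((Num.sqrt (1 + m ^+ 2))^-1, (Num.sqrt (1 + m ^+ 2))^-1 * m) /\
       (\int[@lebesgue_measure R]_t (tiles B G x (t, b + m * t)%R)%:E =
        ((Num.sqrt (1 + m ^+ 2))^-1 * r (line_integral (coloring Q G z) (0, b)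
         ((Num.sqrt (1 + m ^+ 2))^-1, ((Num.sqrt (1 + m ^+ 2))^-1 * m)%R)))%:E)%E}) ->
    forall m, {ae (@lebesgue_measure R), forall b,
      (`|\int[@lebesgue_measure R]_t (tiles B G x (t, b + m * t)%R)%:E| <=
       (eps / Num.sqrt (1 + m ^+ 2))%:E)%E}.
  move=> rw h m; move: (h m); apply: filterS.
    exact: (ae_filter_ringOfSetsType (@lebesgue_measure R)).
  move=> b [mline ->].
  have s0 : 0 <= (Num.sqrt (1 + m ^+ 2))^-1 by rewrite invr_ge0 sqrtr_ge0.
  rewrite abse_EFin lee_fin normrM (ger0_norm s0) [leRHS]mulrC ler_wpM2l//.
  exact: le_trans (rw _) (ltW (line_lt _ _ mline)).
have thinRe := thin (fun g => complex.Re (z g)) (@complex.Re R) _ _.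
have thinIm := thin (fun g => complex.Im (z g)) (@complex.Im R) _ _.
have S0 : 0 < S.
  rewrite lt0r sumr_ge0 ?andbT; last by move=> g _; rewrite sqr_ge0.
  by apply/eqP => S0; move: eps0; rewrite /eps S0 sqrtr0 mulr0 ltxx.
have [g0 g0G] : exists g0, g0 \in G.
  apply: contrapT => nG; move: S0; rewrite /S big1_seq ?ltxx// => g /andP[_ gG].
  by exfalso; apply: nG; exists g.
have D0 : 0 < D.
  rewrite lt0r (le_trans (euclid_ge0 (g0 - g0)) (diam_ge g0G g0G)) andbT.
  have p0 : - 2^-1 != 0 :> R by rewrite oppr_eq0 invr_eq0 pnatr_eq0.
  by apply/eqP => D0; move: eps0; rewrite /eps D0 (powR0 p0) mulr0 mul0r ltxx.
have dD : d <= D.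
  rewrite leNgt; apply/negP => Dd.
  have : D <= 0.
    apply: diam_le0 => g h gG hG; apply: contrapT => gh.
    move: Dd; rewrite ltNge (le_trans _ (diam_ge gG hG))//.
    apply: dT; first by have [_ TB _ _] := lT; apply: TB; apply: GT.
    by rewrite subr_eq0; apply/eqP.
  by rewrite leNgt D0.
have eps2 : eps ^+ 2 = c / (4 * kap) * S / D.
  by rewrite /eps !exprMn C2 powR_inv_sqrt// sqr_sqrtr ?ltW// mulrAC.
have rho0 : 0 <= D + 2 * M by rewrite addr_ge0 ?mulr_ge0// ltW.
have supp x p : tiles B G x p != 0 ->
    (p.1 - g0.1) ^+ 2 + (p.2 - g0.2) ^+ 2 <= (D + 2 * M) ^+ 2.
  move=> tp.
  have [g gG Bpg] : exists2 g, g \in G & B (vadd p (- g)).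
    apply: contrapT => nB; move/eqP : tp; apply.
    rewrite /tiles big1_seq// => g /andP[_ gG]; rewrite indicE memNset ?mulr0//.
    by move=> Bpg; apply: nB; exists g.
  have -> : (p.1 - g0.1) ^+ 2 + (p.2 - g0.2) ^+ 2 = euclid (p - g0) ^+ 2.
    by rewrite sqr_euclid.
  rewrite ler_sqr ?nnegrE ?euclid_ge0//.
  have -> : p - g0 = (g - g0) + (p - g) by rewrite [RHS]addrC addrA subrK.
  apply: le_trans (euclidD _ _) _; rewrite lerD ?diam_ge//.
  apply: le_trans (euclid_le_norm _) _; rewrite ler_wpM2l//.
  exact/QM/BQ.
have disj g h p : g \in G -> h \in G ->
    B (vadd p (- g)) -> B (vadd p (- h)) -> g = h.
  move=> gG hG /BQ Bg /BQ Bh.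
  exact: (fundamental_domain_disjoint lT fd (GT _ gG) (GT _ hG) Bg Bh).
have coreRe : c * \sum_(g <- G) complex.Re (z g) ^+ 2 <= (D + 2 * M) * eps ^+ 2.
  apply: (core G _ _ _ g0) => //; [exact: fset_uniq|exact: supp|].
  apply: thinRe; first by move=> w; have [] := normc_Re_Im w.
  move=> m; move: (gl m); apply: filterS.
    exact: (ae_filter_ringOfSetsType (@lebesgue_measure R)).
  by move=> b [].
have coreIm : c * \sum_(g <- G) complex.Im (z g) ^+ 2 <= (D + 2 * M) * eps ^+ 2.
  apply: (core G _ _ _ g0) => //; [exact: fset_uniq|exact: supp|].
  apply: thinIm; first by move=> w; have [] := normc_Re_Im w.
  move=> m; move: (gl m); apply: filterS.
    exact: (ae_filter_ringOfSetsType (@lebesgue_measure R)).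
  by move=> b [].
have SE : S = \sum_(g <- G) complex.Re (z g) ^+ 2 + \sum_(g <- G) complex.Im (z g) ^+ 2.
  rewrite -big_split/=; apply: eq_bigr => g _.
  by have [_ _ ->] := normc_Re_Im (z g).
have rhoD : D + 2 * M <= kap * D.
  have -> : kap * D = D + 2 * M * D / d by rewrite /kap; field; rewrite gt_eqF.
  by rewrite lerD2l ler_pdivlMr// ler_wpM2l// mulr_ge0.
have : c * S <= 2 * (kap * D * eps ^+ 2).
  rewrite SE mulrDr mulr_natl mulr2n lerD//.
    by apply: le_trans coreRe _; rewrite ler_wpM2r// sqr_ge0.
  by apply: le_trans coreIm _; rewrite ler_wpM2r// sqr_ge0.
have -> : 2 * (kap * D * eps ^+ 2) = c * S / 2.
  by rewrite eps2; field; rewrite !gt_eqF.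
have : 0 < c * S by rewrite mulr_gt0.
lra.
Qed.
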